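(* For each $n$ and threshold $t$, there exist quantum circuits of depth $O(1)$ (a constant independent of $n$ and $t$) implementing exactly the quantum operation $\mathrm{TH}_n^t$, with the following sizes: (i) size $O(n\log n)$ for any $1\le t\le \log n$ or $n-\log n\le t\le n$; (ii) size $O(n\sqrt{t\log n})$ for any $\log n\le t\le\lceil n/2\rceil$; (iii) size $O(n\sqrt{(n-t)\log n})$ for any $\lceil n/2\rceil\le t\le n-\log n$.
   Context: Quantum circuits are built from elementary gates: arbitrary one-qubit gates, CNOT gates, and unbounded fan-out gates. An unbounded fan-out gate on $k+1$ qubits ($k\ge1$) maps $|y\rangle\bigotimes_{j=0}^{k-1}|x_j\rangle \mapsto |y\rangle\bigotimes_{j=0}^{k-1}|x_j\oplus y\rangle$ for $y,x_j\in\{0,1\}$. Circuits may use ancillary qubits initialized to $|0\rangle$. The size of a circuit is the total over its gates of the number of qubits each gate acts on; the depth is the number of layers (input qubits have depth 0, a gate has depth 1 plus the maximal depth of gates it depends on, circuit depth is the maximal gate depth). For an integer $1\le t\le n$ and $x=x_0\cdots x_{n-1}\in\{0,1\}^n$, with $|x|=\sum_j x_j$ the Hamming weight, $\mathrm{TH}_n^t(x)=1$ if $|x|\ge t$ and $0$ otherwise; the quantum operation $\mathrm{TH}_n^t$ maps $\bigl(\bigotimes_{j}|x_j\rangle\bigr)|z\rangle\mapsto\bigl(\bigotimes_{j}|x_j\rangle\bigr)|z\oplus\mathrm{TH}_n^t(x)\rangle$. Logarithms are base 2. *)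

(* Defs.v *)
From HB Require Import structures.
From mathcomp Require Import all_boot all_order all_algebra.
From mathcomp Require Import reals exp.
From mathcomp Require Import complex.
Set Implicit Arguments. Unset Strict Implicit. Unset Printing Implicit Defensive.
Import Order.TTheory GRing.Theory Num.Theory.
Local Open Scope ring_scope.

Section Circuits.
Variable C : numClosedFieldType.
Variable m : nat.

Definition basis := {ffun 'I_m -> bool}.
Definition qstate := basis -> C.

Inductive gate :=
  | G1 of 'I_m & 'M[C]_2
  | CNOT of 'I_m & 'I_m         (* control, target                        *)
  | FanOut of 'I_m & seq 'I_m.

Definition unitary2 (U : 'M[C]_2) : bool := U *m (map_mx Num.conj U)^T == 1%:M.

Definition gate_wf (g : gate) : bool :=
  match g with
  | G1 _ U => unitary2 U
  | CNOT c t => c != t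
  | FanOut y ts => [&& (0 < size ts)%N, uniq ts & y \notin ts]
  end.

Definition gate_wires (g : gate) : seq 'I_m :=
  match g with
  | G1 i _ => [:: i]
  | CNOT c t => [:: c; t]
  | FanOut y ts => y :: ts
  end.

Definition gate_size (g : gate) : nat := size (gate_wires g).

Definition bit2 (v : bool) : 'I_2 := if v then 1 else 0.

Definition setb (b : basis) (i : 'I_m) (v : bool) : basis :=
  [ffun j => if j == i then v else b j].

(* Action of a gate on a state (linear extension of the action on basis
   states):  (g psi)(b) = sum_b' <b|g|b'> psi(b'). *)
Definition gate_apply (g : gate) (psi : qstate) : qstate :=
  match g with
  | G1 i U => fun b => \sum_(v : bool) U (bit2 (b i)) (bit2 v) * psi (setb b i v)
  | CNOT c t => fun b => psi (setb b t (b t (+) b c))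
  | FanOut y ts => fun b => psi [ffun j => if j \in ts then b j (+) b y else b j]
  end.

Definition circuit := seq gate.

Definition circuit_wf (c : circuit) : bool := all gate_wf c.

Definition run (c : circuit) (psi : qstate) : qstate :=
  foldl (fun s g => gate_apply g s) psi c.

Definition csize (c : circuit) : nat := \sum_(g <- c) gate_size g.

(* Depth: a gate has depth 1 + the maximal depth of the earlier gates it
   depends on (those sharing a qubit with it); inputs have depth 0.  We track
   for each wire the depth of the last gate acting on it. *)
Fixpoint depth_aux (d : 'I_m -> nat) (c : circuit) : nat :=
  match c with
  | [::] => \max_(w : 'I_m) d w
  | g :: c' =>
      let k := (\max_(w <- gate_wires g) d w).+1 in
      depth_aux (fun w => if w \in gate_wires g then k else d w) c'
  end.

Definition cdepth (c : circuit) : nat := depth_aux (fun _ => 0%N) c.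

Definition ket (b0 : basis) : qstate := fun b => (b == b0)%:R.

End Circuits.

(* Wires 0..n-1 carry x, wire n carries the target z, wires n+1..n+a are    *)
(* ancillas initialised to |0>.                                             *)

Definition TH (n t : nat) (x : n.-tuple bool) : bool := (t <= count id x)%N.

Definition enc (n a : nat) (x : n.-tuple bool) (z : bool) : basis (n.+1 + a) :=
  [ffun w : 'I_(n.+1 + a) =>
     if (val w < n)%N then nth false x (val w)
     else if val w == n then z else false].

(* The circuit implements TH_n^t exactly (ancillas start and end in |0>):
   |x>|z>|0^a>  |->  |x>|z xor TH_n^t(x)>|0^a>  for all basis inputs,
   hence by linearity on all states of the input/output register. *)
Definition implements_TH (C : numClosedFieldType) (n t a : nat)
    (c : circuit C (n.+1 + a)) : Prop :=
  forall (x : n.-tuple bool) (z : bool),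
    run c (ket C (enc a x z)) = ket C (enc a x (z (+) TH t x)).

Definition log2 (R : realType) (n : nat) : R := ln (n%:R : R) / ln 2.

(* Main.v *)
Require Import Defs.
From HB Require Import structures.
From mathcomp Require Import all_boot all_order all_algebra.
From mathcomp Require Import boolp reals exp.
From mathcomp Require Import complex.
From mathcomp Require Import zify ring lra.
Import Order.TTheory GRing.Theory Num.Theory.
Local Open Scope ring_scope.
Set Implicit Arguments. Unset Strict Implicit. Unset Printing Implicit Defensive.

(* The basic exact gadget tests whether 2^k divides an integer-valued linear form
   L of classical bits: for j < k, a wire prepared by a Hadamard, a phase
   exp(2 pi i L / 2^(j+1)) and another Hadamard is |0> for all j if 2^k | L, while
   otherwise some wire is exactly |1>, namely j = the 2-adic valuation of L; the
   NOR of the k wires is thus classical although the wires need not be, and they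
   can be uncomputed.  All phases, and the NOR through its Fourier expansion, are
   products of phases of parities, which fan-out gates implement in constant depth.

   Let S = |x| + 8^k - t, with 8^k >= t minimal and p = 2^k, so that TH = [S >= p^3].
   Testing p^(s+1) | S - (S mod p^s) - r p^s for all r < p in parallel gives the
   s-th base-p digit of S in one-hot form, and the next test is linear in these
   bits.  Three such steps yield S mod p^3 with size O(n p log p) = O(n sqrt t), and
   S < p^3 iff S - (S mod p^3) = 0, a single divisibility test of size O(n log n).
   For large t the same is done with n - |x| in place of |x|. *)

(** * Operators on states *)

Section Operators.
Variables (C : numClosedFieldType) (m : nat).
Local Notation basis := (basis m).
Local Notation qstate := (qstate C m).
Local Notation gate := (gate C m).
Implicit Types (b : basis) (psi : qstate) (q e w : 'I_m) (g : basis -> bool)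
  (A s T : seq 'I_m).

Lemma setbE b q v w : setb b q v w = if w == q then v else b w.
Proof. by rewrite ffunE. Qed.

Lemma setb_setb b q v v' : setb (setb b q v) q v' = setb b q v'.
Proof. by apply/ffunP => j; rewrite !ffunE; case: eqP. Qed.

Lemma setb_id b q : setb b q (b q) = b.
Proof. by apply/ffunP => j; rewrite !ffunE; case: eqP => [->|]. Qed.

Lemma setbC b q q' v v' : q != q' ->
  setb (setb b q v) q' v' = setb (setb b q' v') q v.
Proof.
move=> qq'; apply/ffunP => j; rewrite !ffunE.
by case: (eqVneq j q) => // ->; rewrite (negPf qq').
Qed.

Definition had_coef : C := (sqrtC 2)^-1.
Definition had_mx : 'M[C]_2 := \matrix_(i, j) (had_coef * (-1) ^+ (i * j)%N).
Definition had q : qstate -> qstate := gate_apply (G1 q had_mx).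

Lemma had_coefM : had_coef * had_coef * 2 = 1.
Proof.
by rewrite /had_coef -invfM -expr2 sqrtCK mulVf // pnatr_eq0.
Qed.

Lemma hadE q psi b : had q psi b =
  had_coef * (psi (setb b q false) + (-1) ^+ b q * psi (setb b q true)).
Proof.
rewrite /had /= big_bool /= !mxE /= addrC mulrDr mulrA.
by case: (b q); rewrite /= ?mulr1 ?expr0 ?expr1.
Qed.

Lemma hadK q psi : had q (had q psi) = psi.
Proof.
apply/funext => b; rewrite !hadE !setb_setb !setbE eqxx /=.
transitivity (had_coef * had_coef * 2 * psi b); last by rewrite had_coefM mul1r.
rewrite -[in RHS](setb_id b q).
by case: (b q); rewrite /= ?expr0 ?expr1; ring.
Qed.

Lemma hadC q q' psi : had q (had q' psi) = had q' (had q psi).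
Proof.
case: (eqVneq q q') => [-> //|qq'].
apply/funext => b; rewrite !hadE !setbE (negPf qq') eq_sym (negPf qq').
by rewrite !(setbC _ _ _ qq'); ring.
Qed.

Lemma hadZ q (a : C) psi :
  had q (fun b => a * psi b) = fun b => a * had q psi b.
Proof. by apply/funext => b; rewrite !hadE; ring. Qed.

Definition indep g w := forall b v, g (setb b w v) = g b.

(** X and Z on wire [e], controlled by an arbitrary classical predicate [g] of the basis state
    instead of a single wire. *)
Definition XG e g psi : qstate := fun b => psi (setb b e (b e (+) g b)).
Definition ZG e g psi : qstate := fun b => (-1) ^+ (b e && g b) * psi b.

(** This is HXH = Z under a control: since [g] ignores [e], it takes one value on the two amplitudes
    that [had e] mixes. *)
Lemma ZG_had e g psi : indep g e -> ZG e g (had e psi) = had e (XG e g psi).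
Proof.
move=> ge; apply/funext => b.
rewrite /ZG hadE hadE /XG !ge !setbE !eqxx !setb_setb.
by case: (b e); case: (g b); rewrite /= ?expr0 ?expr1; ring.
Qed.

Lemma XG_had e g psi : indep g e -> XG e g (had e psi) = had e (ZG e g psi).
Proof.
by move=> ge; rewrite -[LHS](hadK e) -ZG_had // hadK.
Qed.

Lemma XG_hadC e g q psi : q != e -> indep g q ->
  XG e g (had q psi) = had q (XG e g psi).
Proof.
move=> qe gq; apply/funext => b.
rewrite /XG hadE hadE !gq !setbE (negPf qe) eq_sym (negPf qe).
by rewrite !(setbC _ _ _ qe).
Qed.

Fixpoint hads A psi : qstate := if A is q :: A' then hads A' (had q psi) else psi.

Lemma hads_had A q psi : hads A (had q psi) = had q (hads A psi).
Proof. by elim: A psi => //= w A IH psi; rewrite hadC IH. Qed.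

Lemma hadsK A psi : hads A (hads A psi) = psi.
Proof. by elim: A psi => //= q A IH psi; rewrite !hads_had hadK IH. Qed.

Lemma hadsZ A (a : C) psi :
  hads A (fun b => a * psi b) = fun b => a * hads A psi b.
Proof. by elim: A psi => //= q A IH psi; rewrite hadZ IH. Qed.

Lemma hads_rem A q psi : q \in A -> hads A psi = had q (hads (rem q A) psi).
Proof.
elim: A psi => //= w A IH psi; rewrite inE eq_sym.
case: (eqVneq w q) => [-> _|wq /= qA]; first by rewrite hads_had.
by rewrite IH.
Qed.

Lemma XG_hadsC e g A psi : e \notin A -> {in A, forall q, indep g q} ->
  XG e g (hads A psi) = hads A (XG e g psi).
Proof.
elim: A psi => //= q A IH psi; rewrite inE negb_or => /andP[eq eA] gA.
rewrite IH ?XG_hadC //; first by rewrite eq_sym.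
  by apply: gA; rewrite mem_head.
by move=> w wA; apply: gA; rewrite inE wA orbT.
Qed.

Lemma ZG_hads e g A psi : uniq A -> e \in A -> {in A, forall q, indep g q} ->
  ZG e g (hads A psi) = hads A (XG e g psi).
Proof.
move=> uA eA gA; rewrite !(hads_rem _ eA) ZG_had ?XG_hadsC //; last exact: gA.
  by rewrite mem_rem_uniqF.
by move=> w /mem_rem /gA.
Qed.

Lemma XG_hads e g A psi : uniq A -> e \in A -> {in A, forall q, indep g q} ->
  XG e g (hads A psi) = hads A (ZG e g psi).
Proof. by move=> uA eA gA; rewrite -[LHS](hadsK A) -ZG_hads // hadsK. Qed.

Definition CX (c : 'I_m * 'I_m) : qstate -> qstate := XG c.2 (fun b => b c.1).
Definition rev_edge (c : 'I_m * 'I_m) := (c.2, c.1).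

(** Hadamards on both ends exchange control and target: the one on the target turns CNOT into
    controlled Z, which is symmetric in its two wires, and the one on the control turns it back the
    other way round. *)
Lemma CX_hads c A psi : uniq A -> c.1 != c.2 -> c.1 \in A -> c.2 \in A ->
  CX c (hads A psi) = hads A (CX (rev_edge c) psi).
Proof.
case: c => x y /= uA xy xA yA; rewrite /CX /rev_edge /=.
have gx w : w != x -> indep (fun b => b x) w.
  by move=> wx b v; rewrite setbE eq_sym (negPf wx).
have gy w : w != y -> indep (fun b => b y) w.
  by move=> wy b v; rewrite setbE eq_sym (negPf wy).
have yA' : y \in rem x A by rewrite mem_rem_uniq // inE eq_sym xy.
have uA' : uniq (rem x A) by rewrite rem_uniq.
have xA'' : x \notin rem y (rem x A).
  by apply/negP => /mem_rem; rewrite mem_rem_uniqF.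
rewrite !(hads_rem _ xA) !(hads_rem _ yA') hadC XG_had; last by apply: gx; rewrite eq_sym.
have -> phi : ZG y (fun b => b x) phi = ZG x (fun b => b y) phi.
  by apply/funext => b; rewrite /ZG andbC.
rewrite ZG_had; last exact: gy.
rewrite hadC; congr (had x (had y _)).
apply: XG_hadsC => // w; rewrite mem_rem_uniq // inE => /andP[wy _].
exact: gy.
Qed.

Fixpoint CXs (E : seq ('I_m * 'I_m)) psi : qstate :=
  if E is c :: E' then CXs E' (CX c psi) else psi.

Lemma CXs_cat E1 E2 psi : CXs (E1 ++ E2) psi = CXs E2 (CXs E1 psi).
Proof. by elim: E1 psi => /=. Qed.

Lemma CXs_hads E A psi : uniq A ->
    {in E, forall c, [/\ c.1 != c.2, c.1 \in A & c.2 \in A]} ->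
  CXs E (hads A psi) = hads A (CXs (map rev_edge E) psi).
Proof.
move=> uA; elim: E psi => //= c E IH psi EA.
have [c12 c1 c2] := EA c (mem_head _ _).
by rewrite CX_hads // IH // => d dE; apply: EA; rewrite inE dE orbT.
Qed.

Definition xmap (E : seq ('I_m * 'I_m)) b : basis :=
  [ffun w => b w (+) \big[addb/false]_(c <- E | c.2 == w) b c.1].

Definition bipartite (E : seq ('I_m * 'I_m)) :=
  {in E &, forall c d, c.1 != d.2}.

Lemma xmap_src E b w : {in E, forall d, w != d.2} -> xmap E b w = b w.
Proof.
move=> Ew; rewrite ffunE big_seq_cond big1 ?addbF //= => c /andP[/Ew].
by rewrite eq_sym => /negPf ->.
Qed.

(** No source is ever a target, so every CNOT reads an original bit, the order is immaterial, and
    each target collects the XOR of its sources. *)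
Lemma CXsE E psi b : bipartite E -> CXs E psi b = psi (xmap E b).
Proof.
elim: E psi => [|c E IH] psi Eb /=.
  by congr psi; apply/ffunP => w; rewrite ffunE big_nil addbF.
have cE : c \in c :: E by rewrite mem_head.
have sub d : d \in E -> d \in c :: E by rewrite inE orbC => ->.
rewrite IH => [|d d' dE d'E]; last by apply: Eb; apply: sub.
rewrite /CX /XG (@xmap_src _ _ c.1) => [|d dE]; last by apply: Eb => //; apply: sub.
congr psi; apply/ffunP => w; rewrite setbE !ffunE big_cons eq_sym.
by case: eqP => [->|_] //; rewrite addbA addbAC.
Qed.

Lemma xmapK E b : bipartite E -> xmap E (xmap E b) = b.
Proof.
move=> Eb; apply/ffunP => w; rewrite ffunE [xmap E b w]ffunE.
rewrite [X in _ (+) X](_ : _ = \big[addb/false]_(c <- E | c.2 == w) b c.1).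
  by rewrite -addbA addbb addbF.
rewrite big_seq_cond [RHS]big_seq_cond; apply: eq_bigr => c /andP[cE _].
by rewrite xmap_src // => d dE; apply: Eb.
Qed.

Lemma run_cat (c1 c2 : circuit C m) psi : run (c1 ++ c2) psi = run c2 (run c1 psi).
Proof. by rewrite /run foldl_cat. Qed.

Definition edges (f : 'I_m * seq 'I_m) := [seq (f.1, t) | t <- f.2].

Lemma run_fanouts (F : seq ('I_m * seq 'I_m)) psi :
    {in F, forall f, uniq f.2 && (f.1 \notin f.2)} ->
  run [seq FanOut C f.1 f.2 | f <- F] psi = CXs (flatten (map edges F)) psi.
Proof.
elim: F psi => //= -[y ts] F IH psi HF.
rewrite IH => [|f fF]; last by apply: HF; rewrite inE fF orbT.
rewrite CXs_cat; congr CXs; apply/funext => b /=.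
have /= /andP[uts yts] := HF _ (mem_head _ _).
rewrite CXsE => [|c d /mapP[t _ ->] /mapP[t' t'ts ->] /=]; last first.
  by apply: contra yts => /eqP ->.
congr psi; apply/ffunP => w; rewrite !ffunE big_map /=.
case: (boolP (w \in ts)) => wts.
  by rewrite -big_filter filter_pred1_uniq // big_seq1.
rewrite big_seq_cond big1 ?addbF // => t /andP[tts /eqP tw].
by rewrite -tw tts in wts.
Qed.

Lemma hads_run A psi : run [seq G1 q had_mx | q <- A] psi = hads A psi.
Proof. by elim: A psi => //= q A IH psi; rewrite IH. Qed.

Definition phase_mx (u : C) : 'M[C]_2 := \matrix_(i, j) ((i == j)%:R * u ^+ i).

Lemma run_phases (F : seq ('I_m * C)) psi b :
  run [seq G1 f.1 (phase_mx f.2) | f <- F] psi b =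
  (\prod_(f <- F) f.2 ^+ b f.1) * psi b.
Proof.
elim: F psi => [|[p u] F IH] psi /=; first by rewrite big_nil mul1r.
rewrite IH big_cons /= big_bool /= !mxE.
have := setb_id b p; case: (b p) => ->; rewrite /= ?expr0 ?expr1; ring.
Qed.

Lemma unitary_had : unitary2 had_mx.
Proof.
have hr : had_coef^* = had_coef.
  by rewrite /had_coef fmorphV /= conj_Creal // ger0_real // sqrtC_ge0 ler0n.
apply/eqP/matrixP => i j; rewrite !mxE !big_ord_recl big_ord0 /= !mxE.
rewrite !rmorphM !rmorphXn /= rmorphN rmorph1 hr addr0.
have h2 : had_coef * had_coef + had_coef * had_coef = 1.
  by rewrite -had_coefM; ring.
case: i => [[|[|]]] //= ?; case: j => [[|[|]]] //= ?;
  rewrite ?mul0n ?mul1n ?expr0 ?expr1 /= ?muln0 ?expr0 ?expr1; rewrite -?[RHS]h2; ring.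
Qed.

Lemma unitary_phase u : u * u^* = 1 -> unitary2 (phase_mx u).
Proof.
move=> uu; apply/eqP/matrixP => i j; rewrite !mxE !big_ord_recl big_ord0 /= !mxE.
rewrite !rmorphM !rmorphXn /= !conjC_nat addr0.
case: i => [[|[|]]] //= ?; case: j => [[|[|]]] //= ?;
  rewrite -?[LHS]/(_ + _) /= ?expr0 ?expr1 ?mul0r ?mul1r ?add0r ?mulr0 ?addr0 ?mulr1 //.
Qed.

End Operators.
Arguments rev_edge {m} c.

(** * Layered circuits and diagonal blocks *)

Lemma map_uniq_inj (T1 T2 : eqType) (f : T1 -> T2) (s : seq T1) :
  uniq (map f s) -> {in s &, injective f}.
Proof.
elim: s => //= x s IH /andP[xs us] y z; rewrite !inE.
case/predU1P => [->|ys]; case/predU1P => [->|zs] fyz //.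
- by rewrite fyz map_f in xs.
- by rewrite -fyz map_f in xs.
- exact: IH.
Qed.

Lemma big_seq_uniq_key (R : Type) (idx : R) (op : Monoid.com_law idx)
    (T1 T2 : eqType) (f : T1 -> T2) (s : seq T1) (x : T1) (F : T1 -> R) :
  uniq (map f s) -> x \in s ->
  \big[op/idx]_(y <- s | f y == f x) F y = F x.
Proof.
move=> us xs; rewrite big_seq_cond.
rewrite (eq_bigl (fun y => (y \in s) && (y == x))) => [|y]; last first.
  apply: andb_id2l => ys; apply/eqP/eqP => [|-> //].
  exact: (map_uniq_inj us).
rewrite -big_seq_cond -big_filter filter_pred1_uniq ?big_seq1 //.
exact: map_uniq us.
Qed.

Lemma mem_zip (T1 T2 : eqType) (s : seq T1) (t : seq T2) x y :
  (x, y) \in zip s t -> x \in s /\ y \in t.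
Proof.
elim: s t => [|a s IH] [|c t] //=; rewrite !inE => /predU1P[[-> ->]|/IH[-> ->]].
  by rewrite !eqxx.
by rewrite !orbT.
Qed.

Section Layers.
Variables (C : numClosedFieldType) (m : nat).
Local Notation basis := (basis m).
Local Notation qstate := (qstate C m).
Local Notation gate := (gate C m).
Implicit Types (b : basis) (psi : qstate) (q w : 'I_m)
  (A s T : seq 'I_m) (l : seq gate) (ls : seq (seq gate)).

Definition layer_ok l :=
  uniq (flatten (map (@gate_wires C m) l)) && all (@gate_wf C m) l.

(** Induction along the layer: the gates share no wire, so each remaining gate still sees only wires
    of depth at most [k], while the wires already used have reached at most [k.+1]. *)
Lemma depth_aux_layer l (c : circuit C m) (d : 'I_m -> nat) k :
    uniq (flatten (map (@gate_wires C m) l)) -> (forall w, (d w <= k.+1)%N) ->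
    {in flatten (map (@gate_wires C m) l), forall w, (d w <= k)%N} ->
  exists2 d', forall w, (d' w <= k.+1)%N &
    depth_aux d (l ++ c) = depth_aux d' c.
Proof.
elim: l d => [|g l IH] d /=; first by exists d.
rewrite cat_uniq => /and3P[_ /hasPn gl ul] dk dg.
have gk : (\max_(w <- gate_wires g) d w <= k)%N.
  rewrite big_seq; elim/big_ind: _ => // [x y xk yk|w wg]; first by rewrite geq_max xk.
  by apply: dg; rewrite mem_cat wg.
apply: IH => // w => [|wl].
  by case: ifP => _ //; rewrite ltnS.
rewrite (negPf (gl _ wl)); apply: dg.
by rewrite mem_cat wl orbT.
Qed.

Lemma cdepth_layers ls : all layer_ok ls -> (cdepth (flatten ls) <= size ls)%N.
Proof.
suff H : forall (d : 'I_m -> nat) k, (forall w, (d w <= k)%N) -> all layer_ok ls ->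
    (depth_aux d (flatten ls) <= k + size ls)%N.
  by move/H => -/(_ (fun=> 0%N) 0%N); apply.
elim: ls => [|l ls IH] d k dk /=; first by move=> _; rewrite addn0; apply/bigmax_leqP.
case/andP => /andP[ul _] lsok.
have [|w _|d' d'k ->] := depth_aux_layer (flatten ls) (d := d) (k := k) ul.
- by move=> w; apply: leqW.
- exact: dk.
- by rewrite addnS -addSn; apply: IH.
Qed.

Lemma csize_cat (c1 c2 : circuit C m) : csize (c1 ++ c2) = (csize c1 + csize c2)%N.
Proof. by rewrite /csize big_cat. Qed.

Definition clean s psi := forall b w, w \in s -> b w -> psi b = 0.

(** The layers have to realise [F] only on states whose scratch wires [s] are |0>, and [F] must
    return such states; hence implementations compose while reusing the same scratch. *)
Definition impl s (F : qstate -> qstate) (d sz : nat) : Prop :=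
  exists ls, [/\ all layer_ok ls, (size ls <= d)%N, (csize (flatten ls) <= sz)%N &
    forall psi, clean s psi -> run (flatten ls) psi = F psi /\ clean s (F psi)].

Lemma impl_comp s F G d d' sz sz' : impl s F d sz -> impl s G d' sz' ->
  impl s (fun psi => G (F psi)) (d + d') (sz + sz').
Proof.
move=> [l1 [ok1 d1 z1 F1]] [l2 [ok2 d2 z2 G2]]; exists (l1 ++ l2); split.
- by rewrite all_cat ok1.
- by rewrite size_cat leq_add.
- by rewrite flatten_cat csize_cat leq_add.
move=> psi /F1[FE Fc]; rewrite flatten_cat run_cat FE.
by have [-> Gc] := G2 _ Fc.
Qed.

Definition hlayer A : seq gate := [seq G1 q (had_mx C) | q <- A].

Lemma flatten_wires_G1 (T : Type) (f : T -> 'I_m) (U : T -> 'M[C]_2) (r : seq T) :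
  flatten (map (@gate_wires C m) [seq G1 (f x) (U x) | x <- r]) = map f r.
Proof. by elim: r => //= x r ->. Qed.

Lemma hlayer_ok A : uniq A -> layer_ok (hlayer A).
Proof.
move=> uA; rewrite /layer_ok flatten_wires_G1 map_id uA all_map.
by apply/allP => q _; apply: unitary_had.
Qed.

Lemma csize_hlayer A : csize (hlayer A) = size A.
Proof. by rewrite /csize big_map sum1_size. Qed.

Lemma had_clean s q psi : q \notin s -> clean s psi -> clean s (had q psi).
Proof.
move=> qs cpsi b w ws bw; rewrite hadE !(cpsi _ w) ?mulr0 ?addr0 ?mulr0 //;
by rewrite setbE; case: eqP ws qs => // -> ->.
Qed.

Lemma hads_clean s A psi : {in A, forall q, q \notin s} ->
  clean s psi -> clean s (hads A psi).
Proof.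
elim: A psi => //= q A IH psi As cpsi; apply: IH => [w wA|].
  by apply: As; rewrite inE wA orbT.
by apply: had_clean => //; apply: As; rewrite mem_head.
Qed.

Lemma impl_hads s A : uniq A -> {in A, forall q, q \notin s} ->
  impl s (hads A) 1 (size A).
Proof.
move=> uA As; exists [:: hlayer A]; split => //=.
- by rewrite hlayer_ok.
- by rewrite cats0 csize_hlayer.
by move=> psi cpsi; rewrite cats0 hads_run; split => //; apply: hads_clean.
Qed.

(** * One layer of fan-out gates from a bipartite pattern of CNOTs *)

Section FanLayer.
Variable E : seq ('I_m * 'I_m).
Hypothesis E_bip : bipartite E.
Hypothesis E_uniq : uniq (map snd E).

Let targets w := [seq e.2 | e <- E & e.1 == w].
Let sources := [seq w <- enum 'I_m | targets w != [::]].
(** Edges are grouped by source, one fan-out per source. Sources with no target are left out because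
    a fan-out needs at least one. *)
Definition fan_layer : seq gate :=
  [seq FanOut C f.1 f.2 | f <- [seq (w, targets w) | w <- sources]].

Let targetsP w v : v \in targets w -> (w, v) \in E.
Proof. by case/mapP => -[x y] /=; rewrite mem_filter /= => /andP[/eqP -> xE] ->. Qed.

Let uniq_targets w : uniq (targets w).
Proof. by apply: subseq_uniq E_uniq; apply: map_subseq; apply: filter_subseq. Qed.

Let src_targets w w' v : v \in targets w' -> w \in sources -> v != w.
Proof.
move=> /targetsP vw'; rewrite mem_filter => /andP[+ _]; case def: targets => [//|v' r] _.
have : v' \in targets w by rewrite def mem_head.
move=> /targetsP wv'; rewrite eq_sym.
exact: (E_bip wv' vw').
Qed.

(** Wires are disjoint across the gates: each target has a single source by [E_uniq], and no source
    is a target by [E_bip]. *)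
Lemma fan_layer_ok : layer_ok fan_layer.
Proof.
apply/andP; split; last first.
  rewrite !all_map; apply/allP => w ws /=.
  rewrite uniq_targets /=; apply/andP; split.
    by move: ws; rewrite mem_filter => /andP[]; case: targets.
  by apply/negP => /src_targets/(_ ws); rewrite eqxx.
have -> : flatten (map (@gate_wires C m) fan_layer) =
    flatten [seq w :: targets w | w <- sources].
  by rewrite /fan_layer -!map_comp.
have : {subset sources <= sources} by [].
have : uniq sources by rewrite filter_uniq ?enum_uniq.
elim: {1 2 4}sources => //= w ws IH /andP[wws uws] sub.
have wS : w \in sources by apply: sub; rewrite mem_head.
have subS v : v \in ws -> v \in sources by move=> h; apply: sub; rewrite inE h orbT.
rewrite cat_uniq uniq_targets IH //= !andbT; apply/andP; split.
  rewrite mem_cat negb_or; apply/andP; split.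
    by apply/negP => /src_targets/(_ wS); rewrite eqxx.
  apply/negP => /flatten_mapP[w' w'ws]; rewrite inE => /predU1P[ww'|].
    by rewrite ww' w'ws in wws.
  by move=> vw'; have := src_targets vw' wS; rewrite eqxx.
apply/hasPn => v /flatten_mapP[w' w'ws]; rewrite inE => /predU1P[->|vw'].
  by apply/negP => /src_targets/(_ (subS _ w'ws)); rewrite eqxx.
apply/negP => /targetsP vw; move/targetsP: vw' => vw'.
have := map_uniq_inj E_uniq vw vw' (erefl _).
by case => wE; rewrite wE w'ws in wws.
Qed.

Lemma csize_fan_layer : (csize fan_layer <= 2 * size E)%N.
Proof.
rewrite /csize !big_map /gate_size /= big_filter.
have -> : size E = (\sum_(w : 'I_m) size (targets w))%N.
  rewrite (eq_bigr (fun w => \sum_(e <- E | e.1 == w) 1)%N) => [|w _]; last first.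
    by rewrite size_map size_filter sum1_count.
  rewrite (exchange_big_dep predT) //= -sum1_size; apply: eq_bigr => e _.
  by rewrite (big_pred1 e.1) // => i; rewrite eq_sym.
rewrite big_distrr big_enum_cond /= big_mkcond /=.
(* A fan-out with r >= 1 targets touches r + 1 <= 2r wires. *)
by apply: leq_sum => w _; case: (targets w) => //= v r;
  rewrite mul2n -addnn -[in leqLHS]addn1 leq_add2l.
Qed.

Lemma run_fan_layer psi : run fan_layer psi = CXs E psi.
Proof.
rewrite run_fanouts => [|_ /mapP[w ws ->] /=]; last first.
  rewrite uniq_targets; by apply/negP => /src_targets/(_ ws); rewrite eqxx.
apply/funext => b; rewrite !CXsE //; last first.
  move=> c d /flatten_mapP[_ /mapP[w _ ->] /mapP[v /= /targetsP vE ->]].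
  move=> /flatten_mapP[_ /mapP[w' _ ->] /mapP[v' /= /targetsP vE' ->]] /=.
  exact: (E_bip vE vE').
congr psi; apply/ffunP => v; rewrite !ffunE; congr (_ (+) _).
rewrite big_flatten /= !big_map big_filter big_enum_cond /=.
rewrite (eq_bigr (fun w => \big[addb/false]_(e <- E | (e.1 == w) && (e.2 == v)) b e.1)).
  rewrite big_mkcond /=.
  rewrite (eq_bigr (fun w => \big[addb/false]_(e <- E | (e.1 == w) && (e.2 == v)) b e.1)).
    rewrite (exchange_big_dep (fun e => e.2 == v)) /= => [|? ? _ /andP[]//].
    apply: eq_bigr => e ev.
    by rewrite (big_pred1 e.1) // => i; rewrite ev andbT eq_sym.
  (* A wire left out of [sources] has no outgoing edge, so its contribution is an empty XOR. *)
  move=> w _; case: ifPn => //; rewrite negbK /targets => /eqP/(congr1 size).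
  rewrite size_map /= => /size0nil t0; rewrite -big_filter_cond.
  by rewrite t0 big_nil.
move=> w _; rewrite /edges /= !big_map -big_filter_cond [LHS]big_seq_cond.
rewrite [RHS]big_seq_cond; apply: eq_bigr => e /andP[].
by rewrite mem_filter => /andP[/eqP ->].
Qed.

End FanLayer.

Definition parity T b := \big[addb/false]_(w <- T) b w.

Definition dg (fam : seq (seq 'I_m * C)) b : C := \prod_(f <- fam) f.2 ^+ parity f.1 b.

Definition Dg (d : basis -> C) psi : qstate := fun b => d b * psi b.

(** A term needs one accumulator wire and one scratch copy of each wire in its parity. *)
Definition cost (fam : seq (seq 'I_m * C)) := (\sum_(f <- fam) (size f.1).+1)%N.

(** * Products of phases of parities in nine layers *)

Section DiagonalBlock.
(* A term ((T, u), (p, cs)): the parity of [T] is accumulated in the scratch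
   wire [p] through the scratch copies [cs] of the wires of [T]. *)
Variable D : seq ((seq 'I_m * C) * ('I_m * seq 'I_m)).

Definition scratch := flatten [seq t.2.1 :: t.2.2 | t <- D].

Hypothesis uniq_scratch : uniq scratch.
Hypothesis T_copies : {in D, forall t, size t.2.2 = size t.1.1}.
Hypothesis T_scratch : {in D, forall t, {in t.1.1, forall w, w \notin scratch}}.
Hypothesis T_unit : {in D, forall t, t.1.2 * (t.1.2)^* = 1}.

Definition copy_edges := flatten [seq zip t.1.1 t.2.2 | t <- D].
(** The edges run from the accumulator to the copies, which is the direction a fan-out allows;
    Hadamards on the scratch will reverse them, so that the accumulator receives the XOR of its
    copies. *)
Definition fold_edges := flatten [seq [seq (t.2.1, c) | c <- t.2.2] | t <- D].

Lemma perm_scratch :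
  perm_eq scratch ([seq t.2.1 | t <- D] ++ flatten [seq t.2.2 | t <- D]).
Proof.
rewrite /scratch; elim: (D) => //= t D' IH; rewrite perm_cons.
by rewrite perm_sym perm_catCA perm_cat2l perm_sym.
Qed.

Lemma scratch_split : [/\ uniq [seq t.2.1 | t <- D],
  uniq (flatten [seq t.2.2 | t <- D]) &
  {in [seq t.2.1 | t <- D] & flatten [seq t.2.2 | t <- D], forall p c, p != c}].
Proof.
move: uniq_scratch; rewrite (perm_uniq perm_scratch) cat_uniq.
move=> /and3P[up /hasPn pc uc]; split=> // p c pP cC.
by apply: contraNneq (pc _ cC) => <-.
Qed.

Lemma copy_edges_snd : map snd copy_edges = flatten [seq t.2.2 | t <- D].
Proof.
rewrite /copy_edges map_flatten -map_comp; congr flatten.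
apply/eq_in_map => t /T_copies sz; exact: unzip2_zip (eq_leq sz).
Qed.

Lemma fold_edges_snd : map snd fold_edges = flatten [seq t.2.2 | t <- D].
Proof.
rewrite /fold_edges map_flatten -map_comp; congr flatten.
by apply/eq_in_map => t _ /=; rewrite -map_comp map_id.
Qed.

Lemma mem_copy t c : t \in D -> c \in t.2.2 -> c \in flatten [seq t.2.2 | t <- D].
Proof. by move=> tD ct; apply/flattenP; exists t.2.2 => //; apply: map_f. Qed.

Lemma mem_scratch_copy c : c \in flatten [seq t.2.2 | t <- D] -> c \in scratch.
Proof. by move=> cC; rewrite (perm_mem perm_scratch) mem_cat cC orbT. Qed.

Lemma copy_edgesP e : e \in copy_edges ->
  (e.1 \notin scratch) /\ e.2 \in flatten [seq t.2.2 | t <- D].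
Proof.
case: e => x y /flatten_mapP[t tD xy] /=.
split; first by apply: (T_scratch tD); case/mem_zip: xy.
by apply: (mem_copy tD); case/mem_zip: xy.
Qed.

Lemma copy_bip : bipartite copy_edges.
Proof.
move=> c d /copy_edgesP[c1 _] /copy_edgesP[_ /mem_scratch_copy d2].
by apply: contraNneq c1 => ->.
Qed.

Lemma fold_edgesP e : e \in fold_edges ->
  e.1 \in [seq t.2.1 | t <- D] /\ e.2 \in flatten [seq t.2.2 | t <- D].
Proof.
case/flatten_mapP => t tD /mapP[c ct ->] /=; split; first exact: map_f.
exact: (mem_copy tD).
Qed.

Lemma fold_bip : bipartite fold_edges.
Proof.
have [_ _ pc] := scratch_split.
by move=> c d /fold_edgesP[c1 _] /fold_edgesP[_ d2]; apply: pc.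
Qed.

Lemma rev_bip : bipartite (map rev_edge fold_edges).
Proof.
have [_ _ pc] := scratch_split.
move=> _ _ /mapP[c /fold_edgesP[_ c2] ->] /mapP[d /fold_edgesP[d1 _] ->] /=.
by rewrite eq_sym; apply: pc.
Qed.

Definition phase_layer : seq gate :=
  [seq G1 f.1 (phase_mx f.2) | f <- [seq (t.2.1, t.1.2) | t <- D]].

Lemma phase_layer_ok : layer_ok phase_layer.
Proof.
rewrite /layer_ok flatten_wires_G1 -map_comp.
have [-> _ _] := scratch_split; rewrite all_map; apply/allP => _ /mapP[t tD ->] /=.
by apply: unitary_phase; apply: T_unit.
Qed.

(** Copy the wires, form all parities by a fan-out conjugated by Hadamards, put the phase on each
    accumulator, then undo the parities and the copies. *)
Definition dblock : seq (seq gate) :=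
  [:: fan_layer copy_edges; hlayer scratch; fan_layer fold_edges; hlayer scratch;
      phase_layer; hlayer scratch; fan_layer fold_edges; hlayer scratch;
      fan_layer copy_edges].

Lemma dblock_ok : all layer_ok dblock.
Proof.
have [_ uc _] := scratch_split.
rewrite /= !hlayer_ok // phase_layer_ok !fan_layer_ok //.
- exact: fold_bip.
- by rewrite fold_edges_snd.
- exact: copy_bip.
- by rewrite copy_edges_snd.
Qed.

Lemma csize_dblock : (csize (flatten dblock) <= 12 * cost (map fst D))%N.
Proof.
have [_ uc _] := scratch_split.
rewrite /= !csize_cat !csize_hlayer.
have := csize_fan_layer copy_edges; have := csize_fan_layer fold_edges.
rewrite -(size_map snd copy_edges) -(size_map snd fold_edges).
rewrite copy_edges_snd fold_edges_snd.
have -> : csize [::] = 0%N by move=> ? ?; rewrite /csize big_nil.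
have -> : csize phase_layer = size D by rewrite /csize !big_map sum1_size.
rewrite (perm_size perm_scratch) size_cat size_map.
have -> : cost (map fst D) = (size D + size (flatten [seq t.2.2 | t <- D]))%N.
  rewrite /cost big_map size_flatten sumnE big_map big_map -sum1_size -big_split /=.
  by rewrite big_seq [RHS]big_seq; apply: eq_bigr => t /T_copies ->.
(* With d terms and c copies, the four fan-out layers cost at most 8c, the four Hadamard layers 4(c
   + d) and the phases d; the total 12c + 5d is at most 12(c + d). *)
move: (csize (fan_layer fold_edges)) (csize (fan_layer copy_edges)).
by move: (size (flatten _)) (size D) => x y z t; clear; lia.
Qed.

Lemma xmap_dst (E : seq ('I_m * 'I_m)) b e : uniq (map snd E) -> e \in E ->
  xmap E b e.2 = b e.2 (+) b e.1.
Proof. by move=> uE eE; rewrite ffunE big_seq_uniq_key. Qed.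

(** With the scratch at 0, copying makes the copies equal to the wires of the term, and the reversed
    fold XORs them into an accumulator that was 0. *)
Lemma parity_wire b t : {in scratch, forall w, ~~ b w} -> t \in D ->
  xmap (map rev_edge fold_edges) (xmap copy_edges b) t.2.1 = parity t.1.1 b.
Proof.
move=> b0 tD; have [up uc pc] := scratch_split.
rewrite ffunE xmap_src => [|d /copy_edgesP[_ d2]]; last first.
  by apply: pc => //; apply: (map_f (fun t => t.2.1)).
rewrite (negPf (b0 _ _)) ?addFb; last first.
  by rewrite (perm_mem perm_scratch) mem_cat (map_f (fun t => t.2.1)).
rewrite big_map big_flatten /= big_map.
rewrite (eq_bigr (fun t' => if t'.2.1 == t.2.1 then
  \big[addb/false]_(c <- t'.2.2) xmap copy_edges b c else false)); last first.
  by move=> t' _; rewrite big_map /=; case: eqP => // _; rewrite big_pred0.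
(* Accumulators are pairwise distinct, so only the copies of [t] itself reach its accumulator. *)
rewrite -big_mkcond /= (big_seq_uniq_key _ (f := fun t => t.2.1)) //.
rewrite -(unzip2_zip (eq_leq (T_copies tD))) /parity.
rewrite -[in RHS](unzip1_zip (eq_leq (esym (T_copies tD)))) !big_map.
rewrite big_seq [RHS]big_seq; apply: eq_bigr => e eT.
have eC : e \in copy_edges by apply/flatten_mapP; exists t.
rewrite xmap_dst ?copy_edges_snd //.
by have [_ /mem_scratch_copy/b0/negPf ->] := copy_edgesP eC.
Qed.

Lemma run_dblock psi : clean scratch psi ->
  run (flatten dblock) psi = Dg (dg (map fst D)) psi.
Proof.
move=> cpsi; have [_ uc _] := scratch_split.
rewrite /dblock /= !run_cat !hads_run !run_fan_layer ?fold_edges_snd ?copy_edges_snd //;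
  try exact: copy_bip; try exact: fold_bip.
have conj phi : hads scratch (CXs fold_edges (hads scratch phi)) =
    CXs (map rev_edge fold_edges) phi.
  rewrite CXs_hads ?hadsK // => c cE.
  have [c1 c2] := fold_edgesP cE; split.
  - exact: (fold_bip cE cE).
  - by rewrite (perm_mem perm_scratch) mem_cat c1.
  - exact: mem_scratch_copy.
rewrite !conj [run [::] _]/=; apply/funext => b.
rewrite (CXsE _ _ copy_bip) (CXsE _ _ rev_bip) run_phases (CXsE _ _ rev_bip).
rewrite (CXsE _ _ copy_bip) (xmapK _ rev_bip) (xmapK _ copy_bip).
(* If some scratch bit of [b] is 1, the amplitude vanishes on both sides; otherwise the phases can
   be compared term by term. *)
rewrite /Dg; have [/existsP[w /andP[ws bw]]|/existsPn b0] :=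
  boolP [exists w, (w \in scratch) && b w].
  by rewrite (cpsi _ _ ws bw) !mulr0.
congr (_ * _); rewrite /dg !big_map big_seq [RHS]big_seq.
apply: eq_bigr => t tD /=; rewrite parity_wire // => w ws.
by have := b0 w; rewrite ws.
Qed.

End DiagonalBlock.

Fixpoint alloc (fam : seq (seq 'I_m * C)) s :=
  match fam, s with
  | f :: fam', p :: s' =>
      (f, (p, take (size f.1) s')) :: alloc fam' (drop (size f.1) s')
  | _, _ => [::]
  end.

Lemma allocP fam s : (cost fam <= size s)%N ->
  [/\ scratch (alloc fam s) = take (cost fam) s, map fst (alloc fam s) = fam &
    {in alloc fam s, forall t, size t.2.2 = size t.1.1}].
Proof.
rewrite /cost /scratch; elim: fam s => [|f fam IH] s; first by rewrite big_nil take0.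
rewrite big_cons; case: s => [|p s]; first by rewrite leqn0 addn_eq0.
rewrite addSn /= ltnS => szs.
have szf : (size f.1 <= size s)%N by apply: leq_trans szs; apply: leq_addr.
have [|IH1 IH2 IH3] := IH (drop (size f.1) s).
  by rewrite size_drop leq_subRL.
split.
- by rewrite IH1 takeD.
- by rewrite IH2.
move=> t; rewrite inE => /predU1P[->|/IH3 //] /=.
by rewrite size_takel.
Qed.

Lemma impl_Dg s fam : uniq s -> (cost fam <= size s)%N ->
    {in fam, forall f, f.2 * (f.2)^* = 1} ->
    {in fam, forall f, {in f.1, forall w, w \notin s}} ->
  impl s (Dg (dg fam)) 9 (12 * cost fam).
Proof.
move=> us cs fu fs; have [s1 f1 c1] := allocP cs; exists (dblock (alloc fam s)).
have inF t : t \in alloc fam s -> t.1 \in fam by move=> tA; rewrite -f1 map_f.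
have subs w : w \in take (cost fam) s -> w \in s by apply: mem_take.
have uS : uniq (scratch (alloc fam s)) by rewrite s1 take_uniq.
have dS : {in alloc fam s, forall t, {in t.1.1, forall w, w \notin scratch (alloc fam s)}}.
  move=> t /inF tF w wt; rewrite s1; apply: contra (fs _ tF _ wt); exact: subs.
split => //.
- by apply: dblock_ok => // t /inF /fu.
- by apply: leq_trans (csize_dblock uS c1) _; rewrite f1.
move=> psi cpsi; rewrite run_dblock // ?f1.
  by split=> // b w ws bw; rewrite /Dg (cpsi _ _ ws bw) mulr0.
by rewrite s1 => b w /subs; apply: cpsi.
Qed.

End Layers.

(** * Exact divisibility tests *)

Section Zeta.
Variable C : numClosedFieldType.

(* A coherent choice of 2^k-th roots of unity: [zeta k.+1] squares to [zeta k]. *)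
Fixpoint zeta (k : nat) : C :=
  match k with 0 => 1 | 1 => -1 | k'.+1 => sqrtC (zeta k') end.

Lemma zetaS k : zeta k.+1 ^+ 2 = zeta k.
Proof. by case: k => [|k] /=; rewrite ?sqrrN ?expr1n // sqrtCK. Qed.

Lemma zeta_half k : zeta k.+1 ^+ (2 ^ k) = -1.
Proof. by elim: k => [|k IH]; rewrite ?expr1 // expnS exprM zetaS. Qed.

Lemma norm_zeta k : `|zeta k| = 1.
Proof.
elim: k => [|k IH]; first by rewrite normr1.
by apply/eqP; rewrite -(@pexpr_eq1 _ _ 2) // -normrX zetaS IH.
Qed.

Lemma zeta_neq0 k : zeta k != 0.
Proof. by rewrite -normr_eq0 norm_zeta oner_eq0. Qed.

Lemma zeta_unit k (z : int) : zeta k ^ z * (zeta k ^ z)^* = 1.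
Proof.
rewrite -normCK -[RHS](expr1n _ 2); congr (_ ^+ 2).
case: z => n; first by rewrite normrX norm_zeta expr1n.
by rewrite -[_ ^ _]/((_ ^+ n.+1)^-1) normfV normrX norm_zeta expr1n invr1.
Qed.

Lemma zeta_sign k (z : int) : zeta k.+1 ^ ((2 ^ k)%N%:Z * z) = (-1) ^ z.
Proof. by rewrite -exprz_exp -[zeta k.+1 ^ (2 ^ k)%N%:Z]/(zeta k.+1 ^+ (2 ^ k)) zeta_half. Qed.

Lemma zeta_dvd k (z : int) : (2%:Z ^+ k %| z)%Z -> zeta k ^ z = 1.
Proof.
case/dvdzP => y ->; case: k => [|k]; first exact: exp1rz.
have -> : y * 2 ^+ k.+1 = (2 ^ k)%N%:Z * (2 * y).
  by rewrite -[(2 ^ k)%N%:Z]natz natrX exprS; ring.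
by rewrite zeta_sign -exprz_exp -[(-1) ^ 2]/((-1) ^+ 2) sqrrN expr1n exp1rz.
Qed.

(** Here z is 2^k times an odd number, and [zeta k.+1] raised to 2^k is -1. *)
Lemma zeta_dvdN k (z : int) : (2%:Z ^+ k %| z)%Z -> ~~ (2%:Z ^+ k.+1 %| z)%Z ->
  zeta k.+1 ^ z = -1.
Proof.
case/dvdzP => y ->; rewrite exprS dvdz_mul2r ?expf_neq0 //.
rewrite mulrC; have -> : (2 : int) ^+ k = (2 ^ k)%N%:Z by rewrite -[RHS]natz natrX.
rewrite zeta_sign => y2.
have [x ->] : exists x : int, y = 2 * x + 1.
  by exists (y %/ 2)%Z; move: y2; lia.
by rewrite expfzDr ?oppr_eq0 ?oner_eq0 // -exprz_exp -[(-1) ^ 2]/((-1) ^+ 2)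
  sqrrN expr1n exp1rz mul1r.
Qed.

End Zeta.
Arguments zeta : simpl never.

(** * Parallel divisibility tests: compute, flip the targets, uncompute *)

Section Stage.
Variables (C : numClosedFieldType) (m : nat).
Local Notation basis := (basis m).
Local Notation qstate := (qstate C m).
Local Notation gate := (gate C m).
Implicit Types (b : basis) (psi : qstate) (w : 'I_m).

Variables (I : finType) (k lo : nat) (q : I -> 'I_k -> 'I_m) (e : I -> 'I_m).
Variables (lf : seq ('I_m * int)) (cst : I -> int) (s : seq 'I_m).

(** All tests share the linear part [lf] and differ in the constant only. Test [i] takes
    divisibility by 2^lo for granted and decides divisibility by 2^(lo + k) with its [k] phase
    wires. *)
Definition value (i : I) b : int := cst i + \sum_(f <- lf) f.2 *+ b f.1.

Definition phase_wires := [seq q ij.1 ij.2 | ij <- enum {: I * 'I_k}].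
Definition target_wires := [seq e i | i <- enum I].
Local Notation Q := phase_wires.
Local Notation E := target_wires.

Hypothesis wires_uniq : uniq (Q ++ E ++ s).
Hypothesis lf_fresh : {in lf, forall f, f.1 \notin Q ++ E ++ s}.

(** On each phase wire, the controlled phase [zeta] to the power [sg * value]. A product of two bits
    becomes three parities with half the angle, hence the index [(lo + ij.2).+2]; [sg = -1] gives
    the inverse operator. *)
Definition test_family (sg : int) : seq (seq 'I_m * C) :=
  flatten [seq ([:: q ij.1 ij.2], zeta C (lo + ij.2).+1 ^ (sg * cst ij.1)) ::
    flatten [seq [:: ([:: f.1], zeta C (lo + ij.2).+2 ^ (sg * f.2));
                     ([:: q ij.1 ij.2], zeta C (lo + ij.2).+2 ^ (sg * f.2));
                     ([:: f.1; q ij.1 ij.2], zeta C (lo + ij.2).+2 ^ (- (sg * f.2)))]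
            | f <- lf]
  | ij <- enum {: I * 'I_k}].

(** If e = 0 the two phases of a subset S cancel. If e = 1 they combine to [zeta C k.+1] to the
    power +1 or -1 according to the parity over S; these exponents sum to 2^k when all phase wires
    are 0 and to 0 otherwise, so the total sign is -1 exactly in the NOR case. *)
Definition nor_family : seq (seq 'I_m * C) :=
  flatten [seq [:: (e iS.1 :: [seq q iS.1 j | j <- enum iS.2], zeta C k.+1 ^ 1);
                   ([seq q iS.1 j | j <- enum iS.2], zeta C k.+1 ^ (-1))]
          | iS : I * {set 'I_k} <- enum {: I * {set 'I_k}}].

Definition nor (i : I) b := [forall j, ~~ b (q i j)].

Lemma dg_flatten (T : Type) (f : T -> seq (seq 'I_m * C)) (r : seq T) b :
  dg (flatten (map f r)) b = \prod_(x <- r) dg (f x) b.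
Proof. by rewrite /dg big_flatten big_map. Qed.

Lemma dg_cons f (fam : seq (seq 'I_m * C)) b :
  dg (f :: fam) b = f.2 ^+ parity f.1 b * dg fam b.
Proof. by rewrite /dg big_cons. Qed.

Lemma dg_nil b : dg ([::] : seq (seq 'I_m * C)) b = 1.
Proof. by rewrite /dg big_nil. Qed.

Lemma cost_flatten (T : Type) (f : T -> seq (seq 'I_m * C)) (r : seq T) :
  cost (flatten (map f r)) = (\sum_(x <- r) cost (f x))%N.
Proof. by rewrite /cost big_flatten big_map. Qed.

(* The phase a x y is split as (a/2)(x + y - (x (+) y)). *)
Lemma dg_test sg b : dg (test_family sg) b =
  \prod_(ij : I * 'I_k) (zeta C (lo + ij.2).+1 ^ (sg * value ij.1 b)) ^+ b (q ij.1 ij.2).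
Proof.
rewrite /test_family dg_flatten big_enum; apply: eq_bigr => -[i j] _ /=.
rewrite dg_cons /= /parity big_seq1 dg_flatten /value mulrDr expfzDr ?zeta_neq0 //.
rewrite exprMn; congr (_ * _); elim: lf => [|[w a] r IH].
  by rewrite !big_nil mulr0 expr0z expr1n.
rewrite [in RHS]big_cons mulrDr expfzDr ?zeta_neq0 // exprMn -IH big_cons; congr (_ * _).
rewrite !dg_cons dg_nil mulr1 /= /parity !big_cons !big_nil /= !addbF.
have zz : zeta C (lo + j).+2 ^ (sg * a) * zeta C (lo + j).+2 ^ (sg * a) =
          zeta C (lo + j).+1 ^ (sg * a).
  by rewrite -expfzMl -expr2 zetaS.
have zN : zeta C (lo + j).+2 ^ (sg * a) * zeta C (lo + j).+2 ^ (- (sg * a)) = 1.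
  by rewrite -expfzDr ?zeta_neq0 // subrr.
case: (b w); case: (b (q i j)); rewrite /= ?expr0 ?expr1 ?mulr1n ?mulr0n ?mulr0 ?expr0z;
  rewrite ?mul1r ?mulr1 //.
Qed.

Lemma sum_sign_parity i b :
  \sum_(S : {set 'I_k}) (-1) ^+ parity [seq q i j | j <- enum S] b =
  (2 ^ k)%N%:Z *+ nor i b :> int.
Proof.
(* Expanding this product over subsets gives the sum; a single phase wire equal to 1 makes its
   factor vanish. *)
transitivity (\prod_(j < k) ((-1) ^+ b (q i j) + 1 : int)).
  rewrite bigA_distr; apply: eq_bigr => S _; rewrite /parity big_map.
  rewrite -big_mkcond /= -big_enum /=; elim: (enum S) => [|j r IH]; first by rewrite !big_nil.
  by rewrite !big_cons signr_addb IH.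
have [/forallP nb|/forallPn[j bj]] := boolP (nor i b).
  rewrite (eq_bigr (fun=> 2)) => [|j _]; last by rewrite (negPf (nb j)).
  by rewrite prodr_const card_ord -[RHS]natz natrX.
by rewrite (bigD1 j) //= (negPn bj) addNr mul0r.
Qed.

Lemma dg_nor b : dg nor_family b = \prod_(i : I) (-1) ^+ (b (e i) && nor i b).
Proof.
rewrite /nor_family dg_flatten big_enum /=.
rewrite -(pair_bigA _ (fun (i : I) (S : {set 'I_k}) => dg
  [:: (e i :: [seq q i j | j <- enum S], zeta C k.+1 ^ 1);
    ([seq q i j | j <- enum S], zeta C k.+1 ^ (-1))] b)) /=.
apply: eq_bigr => i _.
under eq_bigr => S _.
  rewrite !dg_cons dg_nil mulr1 /= {1}/parity big_cons -/(parity _ b).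
  over.
have z0 := zeta_neq0 C k.+1.
case: (b (e i)) => /=.
  transitivity (\prod_(S : {set 'I_k})
      zeta C k.+1 ^ ((-1) ^+ parity [seq q i j | j <- enum S] b : int)).
    apply: eq_bigr => S _; case: parity => /=.
      by rewrite expr0 mul1r expr1.
    by rewrite expr1 expr0 mulr1.
  have -> (F : {set 'I_k} -> int) : \prod_S zeta C k.+1 ^ F S = zeta C k.+1 ^ (\sum_S F S).
    by apply/esym/big_morph => [x y|]; [apply: expfzDr | apply: expr0z].
  rewrite sum_sign_parity; case: nor; last by rewrite mulr0n expr0z.
  exact: zeta_half.
rewrite big1 // => S _; case: parity; rewrite /= ?expr0 ?mulr1 //.
by rewrite !expr1 -expfzDr.
Qed.

Lemma wires_split : [/\ uniq Q, uniq E, uniq s & [/\ {in E, forall w, w \notin Q},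
  {in s, forall w, w \notin Q} & {in s, forall w, w \notin E}]].
Proof.
move: wires_uniq; rewrite !cat_uniq => /and3P[uQ /hasPn Qd /and3P[uE /hasPn Ed us]].
by split=> //; split=> // w ws; apply: Qd; rewrite mem_cat ws ?orbT.
Qed.

Lemma mem_phase i j : q i j \in Q.
Proof. by apply/mapP; exists (i, j); rewrite ?mem_enum. Qed.

Lemma mem_target i : e i \in E.
Proof. by apply: map_f; rewrite mem_enum. Qed.

Lemma phase_inj : injective (fun ij => q ij.1 ij.2).
Proof.
have [uQ _ _ _] := wires_split.
by move=> x y; apply: (map_uniq_inj uQ); rewrite mem_enum.
Qed.

Lemma target_neq_phase i j l : q j l != e i.
Proof.
have [_ _ _ [EQ _ _]] := wires_split.
by apply: contraNneq (EQ _ (mem_target i)) => <-; apply: mem_phase.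
Qed.

Lemma value_setb i b w v : w \in Q ++ E -> value i (setb b w v) = value i b.
Proof.
move=> wQE; rewrite /value big_seq [in RHS]big_seq; congr (_ + _).
apply: eq_bigr => f flf; rewrite setbE; case: eqP => // fw.
by have := lf_fresh flf; rewrite fw catA mem_cat wQE.
Qed.

Lemma nor_indep i : {in E, forall w, indep (nor i) w}.
Proof.
move=> w /mapP[l _ ->] b v; apply: eq_forallb => j.
by rewrite setbE (negPf (target_neq_phase _ _ _)).
Qed.

Definition XGs (g : I -> basis -> bool) (r : seq I) psi :=
  foldr (fun i phi => XG (e i) (g i) phi) psi r.

Lemma nor_hads r psi :
  Dg (fun b => \prod_(i <- r) (-1) ^+ (b (e i) && nor i b)) (hads E psi) =
  hads E (XGs nor r psi).
Proof.
have [_ uE _ _] := wires_split; elim: r => [|i r IH] /=.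
  by apply/funext => b; rewrite /Dg big_nil mul1r.
rewrite -ZG_hads //; [|exact: mem_target|exact: nor_indep].
rewrite -IH; apply/funext => b.
by rewrite /Dg /ZG big_cons mulrA.
Qed.

(** The phase wires may be in superposition, but if their NOR has a fixed value on the whole
    support, the controlled flips act as classical flips. These no longer involve the phase wires
    and commute with the test. *)
Lemma XGs_const (g : I -> bool) r psi :
    (forall b i, psi b != 0 -> nor i b = g i) ->
  XGs nor r psi = XGs (fun i _ => g i) r psi.
Proof.
move=> psig; have supp : forall b i, XGs (fun i _ => g i) r psi b != 0 -> nor i b = g i.
  elim: r => //= i r IH b l; rewrite /XG => /IH <-.
  by rewrite nor_indep ?mem_target.
elim: r supp => //= i r IH supp.
have supp' b l : XGs (fun i _ => g i) r psi b != 0 -> nor l b = g l.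
  move=> h; have := supp (setb b (e i) (b (e i) (+) g i)) l.
  rewrite nor_indep ?mem_target //; apply.
  by rewrite /XG setb_setb setbE eqxx -addbA addbb addbF setb_id.
rewrite IH //; apply/funext => b; rewrite /XG.
(* Where the NOR differs from [g i], the amplitude is zero for either value of the target, so the
   choice of flip is irrelevant. *)
have [<- //|neq] := eqVneq (nor i b) (g i).
have z v : XGs (fun i _ => g i) r psi (setb b (e i) v) = 0.
  apply: contraNeq neq => /(supp' _ i); rewrite nor_indep ?mem_target // => ->.
  by rewrite eqxx.
by rewrite !z.
Qed.

Lemma XGs_hads (g : I -> bool) r psi :
  XGs (fun i _ => g i) r (hads Q psi) = hads Q (XGs (fun i _ => g i) r psi).
Proof.
have [_ _ _ [EQ _ _]] := wires_split.
elim: r => //= i r ->; rewrite XG_hadsC //; exact/EQ/mem_target.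
Qed.

Lemma dg_test_target sg i b v :
  dg (test_family sg) (setb b (e i) v) = dg (test_family sg) b.
Proof.
rewrite !dg_test; apply: eq_bigr => -[j l] _ /=.
rewrite value_setb ?mem_cat ?mem_target ?orbT //.
by rewrite setbE (negPf (target_neq_phase _ _ _)).
Qed.

Lemma XGs_Dg (g : I -> bool) r sg psi :
  XGs (fun i _ => g i) r (Dg (dg (test_family sg)) psi) =
  Dg (dg (test_family sg)) (XGs (fun i _ => g i) r psi).
Proof.
elim: r => //= i r ->; apply/funext => b.
by rewrite /XG /Dg dg_test_target.
Qed.

Definition test_op sg psi : qstate := hads Q (Dg (dg (test_family sg)) (hads Q psi)).

Lemma XGs_test_op (g : I -> bool) r sg psi :
  XGs (fun i _ => g i) r (test_op sg psi) = test_op sg (XGs (fun i _ => g i) r psi).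
Proof. by rewrite /test_op XGs_hads XGs_Dg XGs_hads. Qed.

Lemma test_opK psi : test_op (-1) (test_op 1 psi) = psi.
Proof.
rewrite /test_op hadsK.
suff DD phi : Dg (dg (test_family (-1))) (Dg (dg (test_family 1)) phi) = phi.
  by rewrite DD hadsK.
apply/funext => b; rewrite /Dg mulrA !dg_test -big_split big1 ?mul1r //= => ij _.
by rewrite -exprMn -expfzDr ?zeta_neq0 // mulN1r mul1r addNr expr0z expr1n.
Qed.

(** Only the phase wires leave the classical state [b0]; this keeps [value] constant on the
    support. *)
Definition offQ b0 psi := forall b, psi b != 0 -> {in [predC Q], b =1 b0}.

Lemma offQ_had b0 w psi : w \in Q -> offQ b0 psi -> offQ b0 (had w psi).
Proof.
move=> wQ psib b; rewrite hadE => nz.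
have [v] : exists v, psi (setb b w v) != 0.
  have [z0|] := eqVneq (psi (setb b w false)) 0; last by exists false.
  exists true; apply: contraNneq nz => ->.
  by rewrite z0 mulr0 addr0 mulr0.
move=> /psib bE w' w'Q; rewrite -bE // setbE; case: eqP => // ww'.
by rewrite !inE ww' wQ in w'Q.
Qed.

Lemma offQ_hads b0 A psi : {subset A <= Q} -> offQ b0 psi -> offQ b0 (hads A psi).
Proof.
elim: A psi => //= w A IH psi AQ psib; apply: IH => [w' w'A|].
  by apply: AQ; rewrite inE w'A orbT.
by apply: offQ_had => //; apply: AQ; rewrite mem_head.
Qed.

Lemma value_offQ i b b0 : {in [predC Q], b =1 b0} -> value i b = value i b0.
Proof.
move=> bb; rewrite /value big_seq [in RHS]big_seq; congr (_ + _).
apply: eq_bigr => f flf; rewrite bb //.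
by have := lf_fresh flf; rewrite mem_cat negb_or => /andP[].
Qed.

(* The stabilizer Z of the initial |0> on [q i j] becomes X after the first
   Hadamards, is multiplied by the phase +-1 of the diagonal operator, and
   becomes Z again after the second ones. *)
Lemma test_op_wire b0 i (j : 'I_k) (v : bool) :
    {in Q, forall w, ~~ b0 w} ->
    zeta C (lo + j).+1 ^ value i b0 = (-1) ^+ v ->
  forall b, test_op 1 (ket C b0) b != 0 -> b (q i j) = v.
Proof.
move=> b00 zv; have [uQ _ _ _] := wires_split.
set psi1 := hads Q (ket C b0); set psi2 := Dg (dg (test_family 1)) psi1.
have qQ := mem_phase i j.
have one_indep : {in Q, forall w, indep (m := m) (fun=> true) w} by [].
have X1 : XG (q i j) (fun=> true) psi1 = psi1.
  rewrite /psi1 XG_hads //; congr hads; apply/funext => b; rewrite /ZG /ket andbT.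
  by case: eqP => [->|]; rewrite ?mulr0 // (negPf (b00 _ qQ)) mul1r.
have off1 : offQ b0 psi1.
  by apply: offQ_hads => // b; rewrite /ket; case: (eqVneq b b0) => [-> //|_]; rewrite eqxx.
have X2 : XG (q i j) (fun=> true) psi2 = fun b => (-1) ^+ v * psi2 b.
  apply/funext => b; rewrite /XG /psi2 /Dg.
  rewrite -[psi1 (setb _ _ _)]/(XG (q i j) (fun=> true) psi1 b) X1.
  have [-> |nz] := eqVneq (psi1 b) 0; first by rewrite !mulr0.
  rewrite mulrA; congr (_ * _); rewrite !dg_test.
  rewrite (bigD1 (i, j)) //= [in RHS](bigD1 (i, j)) //= mulrA; congr (_ * _).
    rewrite value_setb ?mem_cat ?qQ // setbE eqxx mul1r.
    rewrite (value_offQ _ (off1 _ nz)) zv.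
    by case: (v); case: (b (q i j)); rewrite /= ?expr1n ?expr0 ?expr1 ?mulr1 ?mulN1r ?opprK.
  apply: eq_bigr => -[i' j'] neq /=; rewrite value_setb ?mem_cat ?qQ //.
  rewrite setbE; case: eqP => // /(@phase_inj (i', j') (i, j)) ij.
  by rewrite ij eqxx in neq.
have Z3 : ZG (q i j) (fun=> true) (hads Q psi2) = fun b => (-1) ^+ v * hads Q psi2 b.
  by rewrite ZG_hads // X2 hadsZ.
move=> b nz; have /(congr1 (fun f => f b)) := Z3; rewrite /ZG andbT.
move/(mulIf nz)/eqP; case: (v); case: (b _); rewrite // expr0 expr1.
  by rewrite eq_sym eqNr oner_eq0.
by rewrite eqNr oner_eq0.
Qed.

Lemma test_op_nor b0 i : {in Q, forall w, ~~ b0 w} -> (2 ^+ lo %| value i b0)%Z ->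
  forall b, test_op 1 (ket C b0) b != 0 -> nor i b = (2 ^+ (lo + k) %| value i b0)%Z.
Proof.
move=> b00 dlo b nz; apply/forallP/idP => [nb|dk j].
  (* Climb one power of 2 at a time: if 2^(lo + l) divided the value but the next power did not,
     phase wire [l] would be exactly 1, against the NOR. *)
  have : forall l, (l <= k)%N -> (2 ^+ (lo + l) %| value i b0)%Z; last exact.
  elim=> [|l IH] lk; first by rewrite addn0.
  rewrite addnS; apply: contraT => ndl.
  have := test_op_wire (j := Ordinal lk) (v := true) b00 _ nz.
  move=> /(_ i) bv; have := nb (Ordinal lk); rewrite bv //= expr1.
  by apply: zeta_dvdN => //; apply: IH; apply: ltnW.
rewrite (test_op_wire (v := false) b00 _ nz) // expr0.
apply: zeta_dvd; apply: dvdz_trans dk.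
have -> : (lo + k)%N = ((lo + j).+1 + (k - j.+1))%N.
  by rewrite -addnS -addnA subnKC.
by rewrite exprD dvdz_mulr.
Qed.

Lemma XGs_ket (g : I -> bool) b0 b1 :
    {in [predC E], b1 =1 b0} -> (forall i, b1 (e i) = b0 (e i) (+) g i) ->
  XGs (fun i _ => g i) (enum I) (ket C b0) = ket C b1.
Proof.
move=> b1off b1on; have [_ uE _ _] := wires_split.
have step r : XGs (fun i _ => g i) r (ket C b0) =
    ket C (foldr (fun i b => setb b (e i) (b (e i) (+) g i)) b0 r).
  elim: r => //= i r ->; apply/funext => b; rewrite /XG /ket; congr (_%:R); congr nat_of_bool.
  apply/eqP/eqP => [<-|->]; rewrite setb_setb setbE eqxx -addbA addbb addbF setb_id //.
rewrite step; congr ket; apply/ffunP => w.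
have on r i : uniq r -> foldr (fun i b => setb b (e i) (b (e i) (+) g i)) b0 r (e i) =
    b0 (e i) (+) ((i \in r) && g i).
  elim: r => [|l r IH] /=; first by rewrite addbF.
  case/andP => lr ur; rewrite setbE inE.
  have ei : injective e by move=> x y; apply: (map_uniq_inj uE); rewrite mem_enum.
  rewrite (inj_eq ei); case: (eqVneq i l) => [il|_] /=; last exact: IH.
  rewrite -il in lr *.
  by rewrite IH // (negPf lr) /= addbF.
have off r : w \notin E ->
    foldr (fun i b => setb b (e i) (b (e i) (+) g i)) b0 r w = b0 w.
  move=> wE; elim: r => //= i r IH; rewrite setbE; case: eqP => // wi.
  by rewrite wi mem_target in wE.
have [/mapP[i _ ->]|wE] := boolP (w \in E).
  by rewrite on ?enum_uniq // mem_enum b1on.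
by rewrite off // b1off.
Qed.

Lemma cost_test sg : cost (test_family sg) = (#|I| * k * (2 + 7 * size lf))%N.
Proof.
rewrite /test_family cost_flatten big_enum /=.
(* The constant costs 2; each entry of the form costs 2 + 2 + 3 for its two single wires and one
   pair. *)
rewrite (eq_bigr (fun=> 2 + 7 * size lf)%N); last first.
  move=> ij _; rewrite /cost big_cons big_flatten big_map /= -/(cost _); congr (_ + _)%N.
  rewrite (eq_bigr (fun=> 7%N)) ?big_const_seq ?count_predT; last first.
    by move=> f _; rewrite !big_cons big_nil.
  by rewrite iter_addn_0.
by rewrite sum_nat_const card_prod card_ord.
Qed.

Lemma cost_nor : (cost nor_family <= #|I| * 2 ^ k * (2 * k + 3))%N.
Proof.
rewrite /nor_family cost_flatten big_enum /=.
(* The two terms of a subset S cost |S| + 2 and |S| + 1. *)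
apply: (@leq_trans (\sum_(iS : I * {set 'I_k}) (2 * k + 3))%N); last first.
  by rewrite sum_nat_const card_prod -[#|{: {set _}}|]cardsT -powersetT card_powerset cardsT card_ord.
apply: leq_sum => iS _; rewrite /cost !big_cons big_nil /= size_map -cardE.
have : (#|iS.2| <= k)%N by rewrite -[leqRHS](card_ord k) max_card.
by move: #|_| => c; clear; lia.
Qed.

Lemma test_family_unit sg : {in test_family sg, forall f, f.2 * (f.2)^* = 1}.
Proof.
move=> f /flatten_mapP[ij _]; rewrite inE => /predU1P[->|]; first exact: zeta_unit.
case/flatten_mapP => g _; rewrite !inE => /or3P[] /eqP -> /=; exact: zeta_unit.
Qed.

Lemma test_family_fresh sg : {in test_family sg, forall f, {in f.1, forall w, w \notin s}}.
Proof.
have [_ _ _ [_ sQ _]] := wires_split.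
have qs i j : q i j \notin s by apply/negP => /sQ; rewrite mem_phase.
move=> f /flatten_mapP[ij _]; rewrite inE => /predU1P[-> w|].
  by rewrite inE => /eqP ->.
case/flatten_mapP => g glf.
have gs : g.1 \notin s by have := lf_fresh glf; rewrite !mem_cat !negb_or => /and3P[].
rewrite !inE => /or3P[] /eqP -> w; rewrite !inE; try (move/orP=> []); by move=> /eqP ->.
Qed.

Lemma nor_family_unit : {in nor_family, forall f, f.2 * (f.2)^* = 1}.
Proof.
move=> f /flatten_mapP[iS _]; rewrite !inE => /orP[] /eqP -> /=; exact: zeta_unit.
Qed.

Lemma nor_family_fresh : {in nor_family, forall f, {in f.1, forall w, w \notin s}}.
Proof.
have [_ _ _ [_ sQ sE]] := wires_split.
have qs i j : q i j \notin s by apply/negP => /sQ; rewrite mem_phase.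
have es i : e i \notin s by apply/negP => /sE; rewrite mem_target.
move=> f /flatten_mapP[iS _]; rewrite !inE => /orP[] /eqP -> w.
  by rewrite inE => /predU1P[-> //|/mapP[j _ ->]].
by case/mapP => j _ ->.
Qed.

Let cD := (#|I| * k * (2 + 7 * size lf))%N.
Let cO := (#|I| * 2 ^ k * (2 * k + 3))%N.

(** The depth 11 is a diagonal block of nine layers between two Hadamard layers. *)
Lemma impl_test_op sg : (cD <= size s)%N ->
  impl s (test_op sg) 11 (12 * cD + 2 * (#|I| * k)).
Proof.
move=> cDs; have [uQ _ us [_ sQ _]] := wires_split.
have hQ : impl s (hads (C := C) Q) 1 (#|I| * k).
  have sz : (#|I| * k)%N = size Q by rewrite size_map -cardE card_prod card_ord.
  have sQ' : {in Q, forall w, w \notin s} by move=> w wQ; apply/negP => /sQ; rewrite wQ.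
  by rewrite sz; exact: (impl_hads C uQ sQ').
have hD := impl_Dg us _ (@test_family_unit sg) (@test_family_fresh sg).
rewrite cost_test in hD.
have := impl_comp (impl_comp hQ (hD cDs)) hQ; congr impl; rewrite /cD; lia.
Qed.

Lemma impl_nor : (cO <= size s)%N ->
  impl s (fun psi => hads E (Dg (dg nor_family) (hads E psi))) 11 (12 * cO + 2 * #|I|).
Proof.
move=> cOs; have [_ uE us [_ _ sE]] := wires_split.
have hE : impl s (hads (C := C) E) 1 #|I|.
  have -> : #|I| = size E by rewrite size_map -cardE.
  by apply: impl_hads => // w wE; apply/negP => /sE; rewrite wE.
have hD := impl_Dg us (leq_trans cost_nor cOs) nor_family_unit nor_family_fresh.
have [ls [ok d z F]] := impl_comp (impl_comp hE hD) hE; exists ls; split => //.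
by have := cost_nor; rewrite -/cO; lia.
Qed.

(** Three blocks of depth 11: test, NOR into the targets, inverse test. The inverse test restores
    the phase wires exactly, because the flips it must be moved across are classical. *)
Lemma stage : (cD <= size s)%N -> (cO <= size s)%N ->
  exists ls : seq (seq gate), [/\ all (@layer_ok C m) ls, (size ls <= 33)%N,
    (csize (flatten ls) <= 24 * cD + 12 * cO + 4 * (#|I| * k) + 2 * #|I|)%N &
    forall b0 b1, {in Q ++ s, forall w, ~~ b0 w} ->
      (forall i, (2 ^+ lo %| value i b0)%Z) ->
      {in [predC E], b1 =1 b0} ->
      (forall i, b1 (e i) = b0 (e i) (+) (2 ^+ (lo + k) %| value i b0)%Z) ->
      run (flatten ls) (ket C b0) = ket C b1].
Proof.
move=> cDs cOs.
have [ls [ok d z F]] :=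
  impl_comp (impl_comp (impl_test_op 1 cDs) (impl_nor cOs)) (impl_test_op (-1) cDs).
exists ls; split => //; first by lia.
move=> b0 b1 b00 dlo off on.
have cket : clean s (ket C b0).
  move=> b w ws bw; rewrite /ket; case: eqP => // bb; move: bw.
  by rewrite bb (negPf (b00 _ _)) // mem_cat ws orbT.
have b0Q : {in Q, forall w, ~~ b0 w} by move=> w wQ; apply: b00; rewrite mem_cat wQ.
have [-> _] := F _ cket.
set psi := test_op 1 (ket C b0).
have -> : dg nor_family = fun b => \prod_(i <- enum I) (-1) ^+ (b (e i) && nor i b).
  by apply/funext => b; rewrite dg_nor big_enum.
(* Hadamards on the targets turn the NOR signs into controlled flips, which then become constant and
   pass through [test_op] so that it cancels. *)
rewrite nor_hads hadsK (XGs_const (g := fun i => (2 ^+ (lo + k) %| value i b0)%Z)).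
  by rewrite -XGs_test_op test_opK; apply: XGs_ket.
by move=> b i nz; apply: test_op_nor.
Qed.

End Stage.

(** * Threshold circuits *)

Lemma modn_digits p s N : (0 < p)%N ->
  (\sum_(i < s) (N %/ p ^ i %% p) * p ^ i)%N = (N %% p ^ s)%N.
Proof.
move=> p0; elim: s => [|s IH]; first by rewrite big_ord0 expn0 modn1.
have E : N = (N %/ p ^ s %/ p * p ^ s.+1 + (N %/ p ^ s %% p * p ^ s + N %% p ^ s))%N.
  rewrite {1}(divn_eq N (p ^ s)) {1}(divn_eq (N %/ p ^ s) p).
  by rewrite mulnDl expnS mulnA addnA.
have lt : (N %/ p ^ s %% p * p ^ s + N %% p ^ s < p ^ s.+1)%N.
  apply: (@leq_trans ((N %/ p ^ s %% p).+1 * p ^ s)%N).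
    by rewrite mulSn addnC ltn_add2r ltn_pmod // expn_gt0 p0.
  by rewrite expnS leq_mul2r ltn_pmod // orbT.
by rewrite big_ord_recr IH /= [in RHS]E modnMDl (modn_small lt) addnC.
Qed.

Lemma enum_unit : enum {: unit} = [:: tt].
Proof. by rewrite enumT unlock. Qed.

(** * Wire layout, extraction of base-p digits, and the final comparison *)

Section Layout.
Variables (C : numClosedFieldType) (n k M sc : nat) (sg c0 : int).
Variable S : n.-tuple bool -> nat.
Hypothesis SE : forall x, (S x)%:Z = c0 + sg * (count id x)%:Z.

Let p := (2 ^ k)%N.

Let p_gt0 : (0 < p)%N. Proof. by rewrite expn_gt0. Qed.

(* In order: one-hot registers for three base-p digits, phase wires of the digit
   tests (reused for the three digits), phase wires of the final test, scratch. *)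
Definition ancilla : Type :=
  ('I_3 * 'I_(2 ^ k) + 'I_(2 ^ k) * 'I_k + 'I_M + 'I_sc)%type.
HB.instance Definition _ := Finite.on ancilla.

Local Notation m := (n.+1 + #|{: ancilla}|)%N.

Definition anc (v : ancilla) : 'I_m := rshift n.+1 (enum_rank v).
Definition digit_wire (s : 'I_3) (r : 'I_(2 ^ k)) := anc (inl (inl (inl (s, r)))).
Definition digit_phase (r : 'I_(2 ^ k)) (j : 'I_k) := anc (inl (inl (inr (r, j)))).
Definition final_phase (u : unit) (j : 'I_M) := anc (inl (inr j)).
Definition scratch_wires : seq 'I_m := [seq anc (inr j) | j <- enum 'I_sc].
Definition input_wire (i : 'I_n) : 'I_m := lshift _ (widen_ord (leqnSn n) i).
Definition output_wire : 'I_m := lshift _ ord_max.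

Arguments digit_wire s r /.
Arguments digit_phase r j /.
Arguments final_phase u j /.

Definition digit (x : n.-tuple bool) (s : nat) := (S x %/ p ^ s %% p)%N.

Definition register (t : nat) (x : n.-tuple bool) (v : ancilla) : bool :=
  if v is inl (inl (inl (s, r))) then (s < t)%N && (digit x s == r) else false.

Definition digits_known (t : nat) (x : n.-tuple bool) (z : bool) : basis m :=
  [ffun w => match split w with
             | inl j => if (j < n)%N then nth false x j else z
             | inr r => register t x (enum_val r)
             end].

Lemma known_input t x z i : digits_known t x z (input_wire i) = nth false x i.
Proof.
rewrite ffunE /input_wire.
by rewrite (unsplitK (inl (widen_ord (leqnSn n) i))) /= ltn_ord.
Qed.

Lemma known_output t x z : digits_known t x z output_wire = z.
Proof.
by rewrite ffunE /output_wire (unsplitK (inl ord_max)) /= ltnn.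
Qed.

Lemma known_anc t x z v : digits_known t x z (anc v) = register t x v.
Proof.
by rewrite ffunE /anc (unsplitK (inr (enum_rank v))) enum_rankK.
Qed.

Lemma wireP (P : 'I_m -> Prop) : (forall i, P (input_wire i)) -> P output_wire ->
  (forall v, P (anc v)) -> forall w, P w.
Proof.
move=> Pi Po Pa w; case: (splitP w) => [j wj|r wr].
  have [jn|nj] := ltnP j n.
    have -> : w = input_wire (Ordinal jn) by apply: val_inj; rewrite /= wj.
    exact: Pi.
  have -> // : w = output_wire.
  by apply: val_inj; rewrite /= wj /=; apply/eqP; rewrite eqn_leq nj -ltnS ltn_ord.
have -> : w = anc (enum_val r) by apply: val_inj; rewrite /= wr /= enum_valK.
exact: Pa.
Qed.

Lemma known0 x z : digits_known 0 x z = enc _ x z.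
Proof.
apply/ffunP; apply: wireP => [i||v].
- by rewrite known_input ffunE /= ltn_ord.
- by rewrite known_output ffunE /= ltnn eqxx.
rewrite known_anc ffunE /=.
have -> : (n.+1 + enum_rank v < n)%N = false by apply/negP; lia.
have -> : (n.+1 + enum_rank v == n)%N = false by apply/negP; lia.
by case: v => [[[[]|]|]|].
Qed.

Lemma anc_inj : injective anc.
Proof. by move=> u v /rshift_inj /enum_rank_inj. Qed.

Lemma anc_input v i : anc v != input_wire i.
Proof. by rewrite -val_eqE /=; have := ltn_ord i; lia. Qed.

Lemma anc_output v : anc v != output_wire.
Proof. by rewrite -val_eqE /=; lia. Qed.

Lemma input_output i : input_wire i != output_wire.
Proof. by rewrite -val_eqE /=; have := ltn_ord i; lia. Qed.

(** Together with the constant [c0] this is S - (S mod p^t): a one-hot digit is linear in its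
    register, bit [r] of digit [s] having weight r p^s. *)
Definition residue_form (t : nat) : seq ('I_m * int) :=
  [seq (input_wire i, sg) | i <- enum 'I_n] ++
  [seq (digit_wire sr.1 sr.2, - (sr.2 * p ^ sr.1)%N%:Z)
     | sr : 'I_3 * 'I_(2 ^ k) <- enum {: 'I_3 * 'I_(2 ^ k)} & (sr.1 < t)%N].

Lemma size_residue_form t : (size (residue_form t) <= n + 3 * p)%N.
Proof.
rewrite size_cat [X in (X + _)%N]size_map [X in (_ + X)%N]size_map.
rewrite -?enumT -[X in (X + _)%N]cardE card_ord leq_add2l size_filter.
by apply: leq_trans (count_size _ _) _; rewrite -cardE card_prod !card_ord.
Qed.

Lemma count_sum (x : n.-tuple bool) :
  (\sum_(i < n) sg *+ nth false x i) = sg * (count id x)%:Z.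
Proof.
have -> : count id x = (\sum_(i < n) nth false x i)%N.
  rewrite -sum1_count big_mkcond big_tuple; apply: eq_bigr => i _.
  by rewrite (tnth_nth false); case: nth.
rewrite (big_morph Posz PoszD (erefl _)) mulr_sumr; apply: eq_bigr => i _.
by case: nth; rewrite ?mulr1 ?mulr0.
Qed.

(** The form reads only digits below [t], so it has the same value once further digits are known.
    Allowing [t'] beyond [t] is what lets a digit be erased by the stage that wrote it. *)
Lemma residue_formE t t' x z : (t <= t' <= 3)%N -> (t <= 3)%N ->
  c0 + \sum_(f <- residue_form t) f.2 *+ digits_known t' x z f.1 =
  (S x %/ p ^ t * p ^ t)%N%:Z.
Proof.
move=> /andP[tt' _] t3; rewrite big_cat /= !big_map big_filter.
rewrite (eq_bigr (fun i : 'I_n => sg *+ nth false x i)) => [|i _]; last by rewrite known_input.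
rewrite -?enumT big_enum /= count_sum addrA -SE big_enum_cond /=.
have -> : \sum_(sr : 'I_3 * 'I_(2 ^ k) | (sr.1 < t)%N)
    (- (sr.2 * p ^ sr.1)%N%:Z) *+ digits_known t' x z (digit_wire sr.1 sr.2) =
    - (S x %% p ^ t)%N%:Z.
  rewrite -(modn_digits t _ p_gt0).
  transitivity (\sum_(s < 3 | (s < t)%N) \sum_(r < 2 ^ k)
      (- (r * p ^ s)%N%:Z) *+ digits_known t' x z (digit_wire s r)).
    by rewrite pair_big /=; apply: eq_bigl => sr; rewrite andbT.
  rewrite (eq_bigr (fun s : 'I_3 => - (digit x s * p ^ s)%N%:Z)) => [|s st].
    rewrite sumrN (big_morph Posz PoszD (erefl _)); congr (- _).
    by rewrite (big_ord_widen 3 (fun s => (digit x s * p ^ s)%N%:Z)).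
  have dp : (digit x s < 2 ^ k)%N by rewrite ltn_pmod.
  rewrite (bigD1 (Ordinal dp)) //= known_anc /= (leq_trans st tt') eqxx mulr1n.
  rewrite big1 ?addr0 // => r rd; rewrite known_anc /= [_ == _](_ : _ = false) ?andbF //.
  by apply/negP => /eqP dr; move/eqP: rd; apply; apply: val_inj.
rewrite {1}(divn_eq (S x) (p ^ t)) PoszD; ring.
Qed.

Lemma scratch_uniq : uniq scratch_wires.
Proof. by rewrite map_inj_uniq ?enum_uniq // => i j /anc_inj []. Qed.

Lemma size_scratch : size scratch_wires = sc.
Proof. by rewrite size_map size_enum_ord. Qed.

Lemma digit_stage_uniq (s : 'I_3) :
  uniq (phase_wires digit_phase ++ target_wires (digit_wire s) ++ scratch_wires).
Proof.
have uq : uniq (phase_wires digit_phase).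
  by rewrite map_inj_uniq ?enum_uniq // => -[r j] [r' j'] /= /anc_inj [-> ->].
have ut : uniq (target_wires (digit_wire s)).
  by rewrite map_inj_uniq ?enum_uniq // => r r' /= /anc_inj [].
rewrite !cat_uniq scratch_uniq uq ut /= andbT; apply/andP; split; apply/hasPn => w.
  by rewrite mem_cat => /orP[] /mapP[r _ ->]; apply/negP => /mapP[[r' j'] _ /= /anc_inj].
by case/mapP => r _ ->; apply/negP => /mapP[r' _ /= /anc_inj].
Qed.

Lemma final_stage_uniq :
  uniq (phase_wires final_phase ++ target_wires (fun _ : unit => output_wire) ++
        scratch_wires).
Proof.
rewrite !cat_uniq scratch_uniq map_inj_uniq ?enum_uniq /=; last first.
  by move=> [[] j] [[] j'] /= /anc_inj [->].
have -> : target_wires (fun _ : unit => output_wire) = [:: output_wire].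
  by rewrite /target_wires enum_unit.
rewrite andbT /=; apply/andP; split; last first.
  by apply/hasPn => _ /mapP[j _ ->]; rewrite inE anc_output.
rewrite negb_or; apply/andP; split.
  by apply/negP => /mapP[[u j] _ /= /eqP]; rewrite eq_sym (negPf (anc_output _)).
apply/hasPn => _ /mapP[j _ ->]; apply/negP => /mapP[[u j'] _ /= /anc_inj] //.
Qed.

Lemma digit_stage_fresh (s : 'I_3) : {in residue_form s, forall f,
  f.1 \notin phase_wires digit_phase ++ target_wires (digit_wire s) ++ scratch_wires}.
Proof.
move=> f; rewrite mem_cat => /orP[/mapP[i _ ->]|] /=.
  rewrite !mem_cat !negb_or; apply/and3P; split; apply/negP => /mapP[v _] /eqP;
    by rewrite eq_sym (negPf (anc_input _ _)).
case/mapP => -[s' r]; rewrite mem_filter /= => /andP[s's _] -> /=.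
rewrite !mem_cat !negb_or; apply/and3P; split; apply/negP => /mapP[v _] /= /anc_inj //.
by case=> ss; rewrite ss ltnn in s's.
Qed.

Lemma final_stage_fresh : {in residue_form 3, forall f, f.1 \notin
  phase_wires final_phase ++ target_wires (fun _ : unit => output_wire) ++ scratch_wires}.
Proof.
move=> f; rewrite mem_cat => /orP[/mapP[i _ ->]|] /=.
  rewrite !mem_cat !negb_or; apply/and3P; split; apply/negP => /mapP[v _] /eqP.
  - by rewrite eq_sym (negPf (anc_input _ _)).
  - by rewrite (negPf (input_output _)).
  - by rewrite eq_sym (negPf (anc_input _ _)).
case/mapP => -[s' r] _ -> /=.
rewrite !mem_cat !negb_or; apply/and3P; split; apply/negP => /mapP[v _].
- by move=> /= /anc_inj.
- by move/eqP; rewrite (negPf (anc_output _)).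
- by move=> /= /anc_inj.
Qed.

Let cD := (p * k * (2 + 7 * (n + 3 * p)))%N.
Let cO := (p * p * (2 * k + 3))%N.
Let fD := (M * (2 + 7 * (n + 3 * p)))%N.
Let fO := (2 ^ M * (2 * M + 3))%N.

Hypothesis sc_large : [&& cD <= sc, cO <= sc, fD <= sc & fO <= sc]%N.

Local Notation computes ls b0 b1 := (run (flatten ls) (ket C b0) = ket C b1).

(** The stage XORs the tests into register [s], on which they do not depend; hence the same layers
    both write and erase the digit. *)
Lemma digit_stage (s : 'I_3) : exists ls, [/\ all (@layer_ok C m) ls,
  (size ls <= 33)%N,
  (csize (flatten ls) <= 24 * cD + 12 * cO + 4 * (p * k) + 2 * p)%N &
  forall x z, computes ls (digits_known s x z) (digits_known s.+1 x z) /\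
              computes ls (digits_known s.+1 x z) (digits_known s x z)].
Proof.
have /and4P[h1 h2 _ _] := sc_large.
have szD : (p * k * (2 + 7 * size (residue_form s)) <= cD)%N.
  by rewrite /cD leq_mul2l; apply/orP; right; rewrite leq_add2l leq_mul2l size_residue_form.
(* The form is always a multiple of p^s = 2^(s k), so [lo] is [s * k] and [k] phase wires suffice
   for each candidate digit. *)
have := @stage C m 'I_(2 ^ k) k (s * k) digit_phase (digit_wire s) (residue_form s)
  (fun r => c0 - (r * p ^ s)%N%:Z) scratch_wires (digit_stage_uniq s) (@digit_stage_fresh s).
rewrite card_ord size_scratch -/p -/cO.
move=> /(_ (leq_trans szD h1) h2)[ls [ok d z sem]].
exists ls; split => //; first by move: szD z; move: (csize _) (p * k * _)%N => ? ?; lia.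
have pE (j : nat) : (2 : int) ^+ j = (2 ^ j)%N%:Z by rewrite -[RHS]natz natrX.
have clean0 t x zz : {in phase_wires digit_phase ++ scratch_wires,
    forall w, ~~ digits_known t x zz w}.
  by move=> w; rewrite mem_cat => /orP[] /mapP[v _ ->]; rewrite known_anc.
have valE t x zz (r : 'I_(2 ^ k)) : (t == s :> nat) || (t == s.+1) ->
    value (residue_form s) (fun r : 'I_(2 ^ k) => c0 - (r * p ^ s)%N%:Z) r (digits_known t x zz) =
    ((S x %/ p ^ s)%N%:Z - r%:Z) * (2 ^ (s * k))%N%:Z.
  move=> ts; rewrite /value addrAC residue_formE; last 2 first.
  - by have := ltn_ord s; case/orP: ts => /eqP ->; lia.
  - by have := ltn_ord s; lia.
  by rewrite mulrBl -!PoszM [(s * k)%N]mulnC expnM.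
(* After dividing by p^s, the test asks whether S / p^s and [r] agree modulo p, that is, whether [r]
   is digit [s]. *)
have dvE x (r : 'I_(2 ^ k)) : (2 ^+ (s * k + k) %|
    ((S x %/ p ^ s)%N%:Z - r%:Z) * (2 ^ (s * k))%N%:Z)%Z = (digit x s == r :> nat)
    :> bool.
  have -> : (2 : int) ^+ (s * k + k) = p%:Z * (2 ^ (s * k))%N%:Z.
    by rewrite pE addnC expnD PoszM.
  rewrite dvdz_mul2r; last by rewrite -lt0n expn_gt0.
  by rewrite -eqz_mod_dvd !modz_nat eqz_nat [X in _ == X]modn_small.
have step t t' x zz : (t == s :> nat) && (t' == s.+1) || (t == s.+1) && (t' == s :> nat) ->
    computes ls (digits_known t x zz) (digits_known t' x zz).
  move=> tt'; have ts : (t == s :> nat) || (t == s.+1) by lia.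
  apply: sem => //.
  - by move=> r; rewrite valE // pE dvdz_mull.
  - apply: wireP => [i _||[[[[s' r]|v]|v]|v]]; rewrite ?known_input ?known_output // !known_anc //=.
    rewrite !inE => sr; have ss : s' != s.
      by apply: contraNneq sr => ->; apply: map_f; rewrite mem_enum.
    have ss' : s' != s :> nat by rewrite val_eqE.
    by congr (_ && _); lia.
  - move=> r; rewrite valE // dvE !known_anc /=.
    have -> : (s < t)%N = (t == s.+1) by lia.
    have -> : (s < t')%N = (t == s) by lia.
    by case: (digit x s == r); lia.
by move=> x zz; split; apply: step; rewrite !eqxx ?orbT.
Qed.

Hypothesis S_small : forall x, (S x < 2 ^ M)%N.

Lemma final_stage : exists ls, [/\ all (@layer_ok C m) ls, (size ls <= 33)%N,
  (csize (flatten ls) <= 24 * fD + 12 * fO + 4 * M + 2)%N &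
  forall x z, computes ls (digits_known 3 x z) (digits_known 3 x (z (+) (S x < p ^ 3)%N))].
Proof.
have /and4P[_ _ h1 h2] := sc_large.
have szD : (1 * M * (2 + 7 * size (residue_form 3)) <= fD)%N.
  by rewrite /fD mul1n leq_mul2l; apply/orP; right; rewrite leq_add2l leq_mul2l size_residue_form.
have := @stage C m unit M 0 final_phase (fun _ => output_wire) (residue_form 3)
  (fun _ => c0) scratch_wires final_stage_uniq final_stage_fresh.
rewrite card_unit size_scratch [(1 * 2 ^ M * _)%N](_ : _ = fO); last by rewrite mul1n.
move=> /(_ (leq_trans szD h1) h2)[ls [ok d z sem]].
exists ls; split => //; first by move: szD z; move: (csize _) (1 * M * _)%N => ? ?; lia.
move=> x zz; apply: sem.
- by move=> w; rewrite mem_cat => /orP[] /mapP[v _ ->]; rewrite known_anc.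
- by move=> i; rewrite expr0 dvd1z.
- apply: wireP => [i||v]; rewrite ?known_input ?known_anc // !inE.
  by rewrite /target_wires enum_unit inE eqxx.
move=> i; rewrite !known_output /value residue_formE // add0n; congr (_ (+) _).
have -> : (2 : int) ^+ M = (2 ^ M)%N%:Z by rewrite -[RHS]natz natrX.
(* S - (S mod p^3) lies below 2^M, so 2^M divides it only if it is 0, which means S < p^3. *)
rewrite dvdzE /=; apply/idP/idP => [lt|]; first by rewrite divn_small.
apply: contraTT; rewrite -leqNgt => le; rewrite gtnNdvd //.
  by rewrite muln_gt0 divn_gt0 ?expn_gt0 ?p_gt0 ?le.
by apply: leq_ltn_trans (S_small x); apply: leq_trunc_div.
Qed.

End Layout.

Definition not_mx (C : numClosedFieldType) : 'M[C]_2 := \matrix_(i, j) (i != j)%:R.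

Lemma unitary_not (C : numClosedFieldType) : unitary2 (not_mx C).
Proof.
apply/eqP/matrixP => i j; rewrite !mxE !big_ord_recl big_ord0 /= !mxE !conjC_nat addr0.
by case: i => [[|[|]]] //= ?; case: j => [[|[|]]] //= ?;
  rewrite -?val_eqE /= ?mul0r ?mul1r ?mulr0 ?addr0 ?add0r.
Qed.

Lemma run_not (C : numClosedFieldType) (m : nat) (w : 'I_m) (b0 : basis m) :
  run [:: G1 w (not_mx C)] (ket C b0) = ket C (setb b0 w (~~ b0 w)).
Proof.
apply/funext => b; rewrite /run /= big_bool /= !mxE /ket.
have E v : (setb b w v == b0) = (b == setb b0 w (b w)) && (v == b0 w).
  apply/eqP/andP => [<-|[/eqP -> /eqP ->]].
    by rewrite setb_setb setbE eqxx setb_id.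
  by rewrite setb_setb setb_id.
rewrite !E.
have -> : (b == setb b0 w (~~ b0 w)) = (b == setb b0 w (b w)) && (b w == ~~ b0 w).
  apply/eqP/andP => [->|[/eqP bE /eqP bw]]; last by rewrite -bw.
  by rewrite setbE !eqxx.
case: (b == setb _ _ _); rewrite /= ?mulr0 ?addr0 //.
by case: (b w); case: (b0 w); rewrite /= ?mulr0 ?mulr1 ?mul0r ?addr0 ?add0r.
Qed.

(** * Assembly of the comparison circuit *)

Section Threshold.
Variables (C : numClosedFieldType) (n k M : nat) (sg c0 : int).
Variable S : n.-tuple bool -> nat.
Hypothesis SE : forall x, (S x)%:Z = c0 + sg * (count id x)%:Z.
Hypothesis S_small : forall x, (S x < 2 ^ M)%N.

Let p := (2 ^ k)%N.
Let cD := (p * k * (2 + 7 * (n + 3 * p)))%N.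
Let cO := (p * p * (2 * k + 3))%N.
Let fD := (M * (2 + 7 * (n + 3 * p)))%N.
Let fO := (2 ^ M * (2 * M + 3))%N.

Definition residue_test_size : nat :=
  6 * (24 * cD + 12 * cO + 4 * (p * k) + 2 * p) + (24 * fD + 12 * fO + 4 * M + 2).

(** Three digit stages, the final stage, and the digit stages again in reverse order: seven stages
    of depth 33. *)
Lemma residue_test : exists (a : nat) (ls : seq (seq (gate C (n.+1 + a)))),
  [/\ all (@layer_ok _ _) ls, (size ls <= 231)%N,
      (csize (flatten ls) <= residue_test_size)%N &
  forall x z, run (flatten ls) (ket C (enc a x z)) =
              ket C (enc a x (z (+) (S x < p ^ 3)%N))].
Proof.
pose sc := (cD + cO + fD + fO)%N.
have scl : [&& cD <= sc, cO <= sc, fD <= sc & fO <= sc]%N.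
  rewrite /sc; move: cD cO fD fO => a b c d; lia.
exists #|{: ancilla k M sc}|.
have [l0 [ok0 d0 z0 s0]] := digit_stage C SE scl (@Ordinal 3 0 isT).
have [l1 [ok1 d1 z1 s1]] := digit_stage C SE scl (@Ordinal 3 1 isT).
have [l2 [ok2 d2 z2 s2]] := digit_stage C SE scl (@Ordinal 3 2 isT).
have [lf [okf df zf sf]] := final_stage C SE scl S_small.
exists (l0 ++ l1 ++ l2 ++ lf ++ l2 ++ l1 ++ l0); split.
- by rewrite !all_cat ok0 ok1 ok2 okf.
- by rewrite !size_cat; move: d0 d1 d2 df; clear; lia.
- rewrite !flatten_cat !csize_cat /residue_test_size; move: z0 z1 z2 zf.
  rewrite -/p -/cD -/cO -/fD -/fO.
  move: (csize _) (csize _) (csize _) (csize _) (24 * _ + _ + _ + _)%N (24 * _ + _ + _ + _)%N.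
  clear; lia.
move=> x z; rewrite -!(known0 k M sc S).
rewrite !flatten_cat !run_cat.
have [r01 r10] := s0 x z; have [r12 r21] := s1 x z; have [r23 r32] := s2 x z.
(* The digits are erased after the output has been flipped, so the erasing statements are taken at
   the new output bit. *)
have [_ r10'] := s0 x (z (+) (S x < p ^ 3)%N); have [_ r21'] := s1 x (z (+) (S x < p ^ 3)%N).
have [_ r32'] := s2 x (z (+) (S x < p ^ 3)%N).
by rewrite r01 r12 r23 sf r32' r21' r10'.
Qed.

Lemma residue_test_circuit (neg : bool) (t : nat) :
    (forall x, TH t x = neg (+) (S x < p ^ 3)%N) ->
  exists (a : nat) (circ : circuit C (n.+1 + a)),
    [/\ circuit_wf circ, implements_TH t circ, (cdepth circ <= 232)%N &
        (csize circ <= residue_test_size + 1)%N].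
Proof.
move=> THE; have [a [ls [ok d z sem]]] := residue_test.
pose out : 'I_(n.+1 + a) := lshift a ord_max.
pose ls' := ls ++ (if neg then [:: [:: G1 out (not_mx C)]] else [::]).
have ok' : all (@layer_ok _ _) ls'.
  by rewrite /ls' all_cat ok; case: neg {THE ls'}; rewrite //= /layer_ok /= unitary_not.
exists a, (flatten ls'); split.
- rewrite /circuit_wf; elim: (ls') ok' => //= l r IH /andP[/andP[_ okl] /IH].
  by rewrite all_cat okl.
- move=> x zz; rewrite /ls' flatten_cat run_cat sem THE.
  case: neg {THE ls' ok'} => /=; last by rewrite ?cats0.
  rewrite -[LHS]/(run [:: G1 out (not_mx C)] _) run_not.
  congr ket; apply/ffunP => w; rewrite !ffunE /=.
  rewrite ltnn eqxx -val_eqE /=.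
  case: (ltnP w n) => wn; first by rewrite (ltn_eqF wn).
  by case: eqP => // _; rewrite addbN.
- apply: leq_trans (cdepth_layers ok') _.
  by rewrite size_cat; move: d; case: neg {THE ls' ok'} => /=; lia.
rewrite flatten_cat csize_cat leq_add //.
by case: neg {THE ls' ok'}; rewrite /csize /= ?big_cons big_nil.
Qed.

End Threshold.

(** * Integer size estimates and choice of parameters *)

Lemma residue_test_size_bound n k M (p := (2 ^ k)%N) :
    (p <= 8 * n)%N -> (2 ^ M <= 32 * n)%N -> (0 < n)%N -> (0 < M)%N ->
  (residue_test_size n k M + 1 <= 30 * (1000 * (n * (p * k.+1 + M))))%N.
Proof.
move=> pn Mn n0 M0; rewrite /residue_test_size -/p.
have p0 : (0 < p)%N by rewrite expn_gt0.
move: (2 ^ M)%N Mn p pn p0 => P Pn p pn p0.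
have e1 : (p * k * (2 + 7 * (n + 3 * p)) <= 177 * (n * (p * k)))%N.
  (* From p <= 8n and n >= 1: 2 + 7 * 25n <= 177n. *)
  have : (2 + 7 * (n + 3 * p) <= 177 * n)%N by lia.
  by move/(leq_mul (leqnn (p * k))) => h; apply: leq_trans h _; lia.
have e2 : (p * p * (2 * k + 3) <= 24 * (n * (p * k.+1)))%N.
  have : (p * p <= 8 * n * p)%N by rewrite leq_mul2r pn orbT.
  have : (2 * k + 3 <= 3 * k.+1)%N by lia.
  by move=> h1 h2; apply: leq_trans (leq_mul h2 h1) _; lia.
have e3 : (M * (2 + 7 * (n + 3 * p)) <= 177 * (n * M))%N.
  have : (2 + 7 * (n + 3 * p) <= 177 * n)%N by lia.
  by move/(leq_mul (leqnn M)) => h; apply: leq_trans h _; lia.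
have e4 : (P * (2 * M + 3) <= 160 * (n * M))%N.
  have : (2 * M + 3 <= 5 * M)%N by lia.
  by move=> h; apply: leq_trans (leq_mul Pn h) _; lia.
have e5 : (p * k.+1 <= n * (p * k.+1))%N by rewrite leq_pmull.
have e6 : (M <= n * M)%N by rewrite leq_pmull.
have e7 : (n * (p * k) + n * p = n * (p * k.+1))%N by lia.
have e8 : (p * k + p = p * k.+1)%N by lia.
rewrite [(n * (_ + M))%N]mulnDr; move: e1 e2 e3 e4 e5 e6 e7 e8 M0 p0.
move: (p * k * _)%N (p * p * _)%N (M * (2 + _))%N (P * _)%N => A1 A2 A3 A4.
move: (n * (p * k))%N (n * (p * k.+1))%N (n * M)%N (p * k)%N (p * k.+1)%N (n * p)%N.
clear; lia.
Qed.

(** For the least [k] with p^3 >= t, where p = 2^k, minimality gives p^3 = O(t). Since (k + 1)^2 =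
    O(p), the digit cost p (k + 1) has square O(p^3), so it is O(sqrt t). *)
Lemma cube_root_exists t : (0 < t)%N -> exists k,
  [/\ (t <= (2 ^ k) ^ 3)%N, ((2 ^ k) ^ 3 <= 8 * t)%N &
      ((2 ^ k * k.+1) ^ 2 <= 32 * t)%N].
Proof.
move=> t0; have ex : exists k, (t <= (2 ^ k) ^ 3)%N.
  exists t; apply: leq_trans (ltnW (ltn_expl t (ltnSn 1))) _.
  by rewrite -{1}[(2 ^ t)%N]expn1 leq_pexp2l // expn_gt0.
case: (ex_minnP ex) => -[|j] tk kmin; first by exists 0%N; split => //=; lia.
have jt : ((2 ^ j) ^ 3 < t)%N.
  by rewrite ltnNge; apply/negP => /kmin; rewrite ltnn.
exists j.+1; split => //; first by rewrite (expnS 2 j) expnMn; lia.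
have pol : (j.+2 ^ 2 <= 8 * 2 ^ j)%N.
  elim: j {tk kmin jt} => // -[|j] IH //; rewrite (expnS 2); move: IH; nia.
rewrite (expnS 2 j); move: (2 ^ j)%N jt pol => P jt pol.
apply: (@leq_trans (4 * P ^ 2 * (8 * P))%N); last by lia.
by rewrite !expnMn; rewrite leq_mul.
Qed.

Lemma count_le n (x : n.-tuple bool) : (count id x <= n)%N.
Proof. by rewrite -{2}(size_tuple x) count_size. Qed.

Definition size_bound (n t sz : nat) := exists2 X : nat, (X ^ 2 <= 32 * t)%N &
  (sz <= 30 * (1000 * (n * (X + (trunc_log 2 n + 5)))))%N.

(** The choice [t' = n.+1 - t] counts zeros instead of ones: |x| >= t exactly when n - |x| < n + 1 -
    t. *)
Lemma TH_circuit (C : numClosedFieldType) n t t' : (0 < t <= n)%N ->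
    t' = t \/ t' = (n.+1 - t)%N ->
  exists (a : nat) (circ : circuit C (n.+1 + a)),
    [/\ circuit_wf circ, implements_TH t circ, (cdepth circ <= 232)%N &
        size_bound n t' (csize circ)].
Proof.
move=> /andP[t0 tn] t'E; have t'0 : (0 < t' <= n)%N by lia.
have [k [tk kt X]] := cube_root_exists (proj1 (andP t'0)).
have n0 : (0 < n)%N by lia.
(* S is at most 8^k - t' + n <= 8n, safely below 2^M, which lies between 16n and 32n. *)
pose M := (trunc_log 2 n + 5)%N.
have /andP[ln nl] := trunc_log_bounds (ltnSn 1) n0.
have ME : (2 ^ M = 32 * 2 ^ trunc_log 2 n)%N by rewrite expnD mulnC.
have Mn : (16 * n < 2 ^ M)%N by move: nl; rewrite ME expnS; lia.
have nM : (2 ^ M <= 32 * n)%N by rewrite ME leq_mul2l.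
have pn : (2 ^ k <= 8 * n)%N.
  apply: leq_trans (_ : (2 ^ k) ^ 3 <= _)%N; last by lia.
  by rewrite -{1}[(2 ^ k)%N]expn1 leq_pexp2l // expn_gt0.
suff [a [circ [wf imp d sz]]] : exists (a : nat) (circ : circuit C (n.+1 + a)),
    [/\ circuit_wf circ, implements_TH t circ, (cdepth circ <= 232)%N &
        (csize circ <= residue_test_size n k M + 1)%N].
  exists a, circ; split=> //; exists (2 ^ k * k.+1)%N => //.
  apply: leq_trans sz _; apply: residue_test_size_bound => //.
  by rewrite /M addnS.
case: t'E => t'E.
(* S = 8^k - t + |x| is below 8^k exactly when |x| < t, so the output bit has to be negated. *)
- apply: (@residue_test_circuit C n k M 1 ((2 ^ k) ^ 3 - t)%N%:Z
    (fun x => (2 ^ k) ^ 3 - t + count id x)%N _ _ true).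
  + by move=> x; rewrite PoszD mul1r.
  + by move=> x; have := count_le x; move: Mn tk kt; lia.
  + move=> x; rewrite /TH; move: tk; rewrite t'E.
    by move: (2 ^ k)%N (count id x) => P c; move: (P ^ 3)%N => Q; lia.
apply: (@residue_test_circuit C n k M (-1) ((2 ^ k) ^ 3 - t' + n)%N%:Z
    (fun x => (2 ^ k) ^ 3 - t' + (n - count id x))%N _ _ false).
+ by move=> x; have := count_le x; rewrite !PoszD; lia.
+ by move=> x; have := count_le x; move: Mn tk kt; lia.
move=> x; rewrite /TH; have := count_le x; move: tk.
by move: (2 ^ k)%N (count id x) => P c; move: (P ^ 3)%N => Q; lia.
Qed.

(** * Passage to real logarithms and square roots *)

Section RealBounds.
Variable R : realType.

Lemma trunc_log_le_log2 n : (0 < n)%N -> (trunc_log 2 n)%:R <= log2 R n.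
Proof.
move=> n0; have ln2 : 0 < ln (2 : R) by rewrite ln_gt0 // ltr1n.
rewrite /log2 ler_pdivlMr // mulr_natl -lnXn ?ltr0n //.
rewrite ler_ln ?posrE ?exprn_gt0 ?ltr0n // -natrX ler_nat.
by have /andP[] := trunc_log_bounds (ltnSn 1) n0.
Qed.

Lemma log2_ge1 n : (2 <= n)%N -> 1 <= log2 R n.
Proof.
move=> n2; apply: le_trans (trunc_log_le_log2 (ltnW n2)).
by rewrite ler1n trunc_log_gt0 n2.
Qed.

Lemma size_bound_real n t sz : (2 <= n)%N -> size_bound n t sz ->
  sz%:R <= 180 * 1000 * n%:R * (Num.sqrt t%:R + log2 R n).
Proof.
move=> n2 [X Xt szX]; have L1 := log2_ge1 n2.
have := trunc_log_le_log2 (ltnW n2); set L := log2 R n in L1 * => lL.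
(* 32 is rounded up to 6^2; likewise [trunc_log 2 n + 5] is at most 6 log n because log n >= 1,
   whence 180 = 30 * 6. *)
have X6 : X%:R <= 6 * Num.sqrt (t%:R : R).
  have -> : (6 : R) = Num.sqrt (6 ^+ 2) by rewrite sqrtr_sqr ger0_norm.
  rewrite -sqrtrM ?exprn_ge0 // -[X%:R]ger0_norm // -sqrtr_sqr ler_wsqrtr //.
  rewrite -!natrX -natrM ler_nat; apply: leq_trans Xt _.
  by rewrite leq_mul2r orbT.
have n0 : 0 <= (n%:R : R) by [].
apply: le_trans (_ : (30 * (1000 * (n * (X + (trunc_log 2 n + 5)))))%N%:R <= _).
  by rewrite ler_nat.
rewrite !natrM !natrD.
have -> : 180 * 1000 * n%:R * (Num.sqrt t%:R + L) =
    30%:R * (1000%:R * (n%:R * (6 * Num.sqrt t%:R + 6 * L))) :> R by ring.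
rewrite !ler_wpM2l //; lra.
Qed.

End RealBounds.

Unset Implicit Arguments.
Theorem theorem2 (R : realType) :
  exists (D : nat) (c : R) (N : nat),
  forall (n t : nat), (N <= n)%N -> (1 <= t <= n)%N ->
  (* (i) *)
  ((t%:R <= log2 R n \/ n%:R - log2 R n <= t%:R) ->
     exists (a : nat) (circ : circuit R[i] (n.+1 + a)),
       [/\ circuit_wf circ, implements_TH t circ, (cdepth circ <= D)%N
         & (csize circ)%:R <= c * n%:R * log2 R n]) /\
  (* (ii) *)
  ((log2 R n <= t%:R /\ (t <= uphalf n)%N) ->
     exists (a : nat) (circ : circuit R[i] (n.+1 + a)),
       [/\ circuit_wf circ, implements_TH t circ, (cdepth circ <= D)%N
         & (csize circ)%:R <= c * n%:R * Num.sqrt (t%:R * log2 R n)]) /\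
  (* (iii) *)
  (((uphalf n <= t)%N /\ t%:R <= n%:R - log2 R n) ->
     exists (a : nat) (circ : circuit R[i] (n.+1 + a)),
       [/\ circuit_wf circ, implements_TH t circ, (cdepth circ <= D)%N
         & (csize circ)%:R <= c * n%:R * Num.sqrt ((n - t)%:R * log2 R n)]).
Proof.
(* n >= 2 ensures log n >= 1. The constant 540 is 3 * 180, where 3 is the largest ratio of sqrt t' +
   log n to the target bound in the cases below. *)
exists 232%N, (540 * 1000), 2 => n t n2 tn.
have L1 := log2_ge1 R n2; set L := log2 R n in L1 *.
have L0 : 0 <= L by lra.
have n0 : 0 <= (n%:R : R) by [].
have /andP[t1 tn'] := tn.
have H t' : t' = t \/ t' = (n.+1 - t)%N -> forall B : R,
    Num.sqrt t'%:R + L <= 3 * B ->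
    exists (a : nat) (circ : circuit R[i] (n.+1 + a)),
       [/\ circuit_wf circ, implements_TH t circ, (cdepth circ <= 232)%N
         & (csize circ)%:R <= 540 * 1000 * n%:R * B].
  move=> t'E B le; have [a [circ [wf imp d /(size_bound_real R n2) sz]]] :=
    TH_circuit R[i] tn t'E.
  exists a, circ; split => //; apply: le_trans sz _.
  have -> : 540 * 1000 * n%:R * B = 180 * 1000 * n%:R * (3 * B) by ring.
  by rewrite ler_wpM2l // !mulr_ge0.
have sqrtL (a B : R) : 0 <= B -> a <= B ^+ 2 -> Num.sqrt a <= B.
  by move=> B0 aB; rewrite -[leRHS]ger0_norm // -sqrtr_sqr ler_wsqrtr.
have t'R : (n.+1 - t)%:R = n%:R - t%:R + 1 :> R by rewrite natrB ?leqW // -natr1; ring.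
split; [case => tL | split; case].
(* Here t <= L <= L^2. *)
- apply: (H t (or_introl erefl)); suff : Num.sqrt (t%:R : R) <= L by lra.
  by apply: sqrtL => //; nra.
(* Here t' = n - t + 1 <= L + 1 <= (2 L)^2. *)
- apply: (H _ (or_intror erefl)); suff : Num.sqrt ((n.+1 - t)%:R : R) <= 2 * L by lra.
  by apply: sqrtL; [lra|rewrite t'R; nra].
(* Both summands are at most sqrt(t L): the first because L >= 1, the second because L <= t. *)
- move=> Lt _; apply: (H t (or_introl erefl)).
  have t0 : 0 <= (t%:R : R) by [].
  have : Num.sqrt (t%:R : R) <= Num.sqrt (t%:R * L) by rewrite ler_wsqrtr //; nra.
  have : L <= Num.sqrt (t%:R * L).
    by rewrite -[leLHS]ger0_norm // -sqrtr_sqr ler_wsqrtr //; nra.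
  lra.
(* Now t' = d + 1 with d = n - t >= L >= 1, so d + 1 <= 4 d L absorbs the extra unit. *)
move=> _ tL; apply: (H _ (or_intror erefl)); rewrite t'R natrB //.
set d : R := n%:R - t%:R; have Ld : L <= d by rewrite /d; lra.
have s0 := sqrtr_ge0 (d * L).
have d0 : 0 <= d * L by rewrite mulr_ge0 //; lra.
have : L <= Num.sqrt (d * L).
  by rewrite -[leLHS]ger0_norm // -sqrtr_sqr ler_wsqrtr //; nra.
have : Num.sqrt (d + 1) <= 2 * Num.sqrt (d * L).
  by apply: sqrtL; [lra|rewrite exprMn sqr_sqrtr //; nra].
lra.
Qed.
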